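(* Let $\mathbb{K}$ be a field with an automorphism $a\mapsto\overline{a}$ of order two, and let $\mathbb{F}$ be its fixed field. Let $f\in\mathbb{F}[x_1,\dots,x_m]$ be multiaffine. Then $f$ has a representation of the form $$f=\lambda\det\big(V\,\mathrm{diag}(x_1,\dots,x_m)\,V^*+W\big)=\lambda\det\Big(\sum_{i=1}^m x_i v_iv_i^*+W\Big)$$ for some $n$, some $\lambda\in\mathbb{F}$, some matrix $V=(v_1,\dots,v_m)\in\mathbb{K}^{n\times m}$ with columns $v_i$ and some $n\times n$ Hermitian matrix $W$ over $\mathbb{K}$, if and only if for all $i,j\in\{1,\dots,m\}$ the polynomial $\Delta_{ij}(f)$ is a Hermitian square in $\mathbb{K}[x_1,\dots,x_m]$. Moreover, in this case one can always take a representation of this form of size $n=\deg(f)$.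
   Context: Multiaffine means of degree at most $1$ in each variable. The Rayleigh difference is $\Delta_{ij}(f)=\frac{\partial f}{\partial x_i}\frac{\partial f}{\partial x_j}-f\,\frac{\partial^2 f}{\partial x_i\partial x_j}$. The involution extends to $\mathbb{K}[x_1,\dots,x_m]$ by acting on coefficients. A polynomial $q\in\mathbb{F}[x_1,\dots,x_m]$ is a Hermitian square if $q=g\overline{g}$ for some $g\in\mathbb{K}[x_1,\dots,x_m]$. For a matrix $M$ over $\mathbb{K}$, $M^*=\overline{M}^T$, and $M$ is Hermitian if $M=M^*$. *)

(* Defs.v *)
From HB Require Import structures.
From mathcomp Require Import all_boot all_order all_algebra.
From mathcomp Require Import mpoly.

Set Implicit Arguments.
Unset Strict Implicit.
Unset Printing Implicit Defensive.

Import GRing.Theory.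
Local Open Scope ring_scope.

(* K is the big field, sigma the involution a |-> \overline{a}.  The fixed      *)
(* field F is represented as a predicate on K, and F[x_1..x_m] as the           *)
(* polynomials over K all of whose coefficients satisfy that predicate.         *)
Definition fixed_field (K : fieldType) (sigma : {rmorphism K -> K}) : {pred K} :=
  [pred a | sigma a == a].

Definition order_two (K : fieldType) (sigma : {rmorphism K -> K}) : Prop :=
  involutive sigma /\ ~ (sigma =1 id).

Definition multiaffine (K : fieldType) (m : nat) (f : {mpoly K[m]}) : Prop :=
  forall mu : 'X_{1..m}, mu \in msupp f -> forall i : 'I_m, (mu i <= 1)%N.

Definition rayleigh_diff (K : fieldType) (m : nat) (i j : 'I_m)
    (f : {mpoly K[m]}) : {mpoly K[m]} :=
  f^`M(i) * f^`M(j) - f * f^`M(j)^`M(i).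

(* No separate requirement that q have coefficients in F is needed: it          *)
(* follows from the equation when sigma is an involution.                       *)
Definition hermitian_square (K : fieldType) (sigma : {rmorphism K -> K})
    (m : nat) (q : {mpoly K[m]}) : Prop :=
  exists g : {mpoly K[m]}, q = g * map_mpoly sigma g.

Definition conj_trmx (K : fieldType) (sigma : {rmorphism K -> K})
    (p q : nat) (M : 'M[K]_(p, q)) : 'M[K]_(q, p) :=
  (map_mx sigma M)^T.

Definition hermitian_mx (K : fieldType) (sigma : {rmorphism K -> K})
    (n : nat) (M : 'M[K]_n) : Prop :=
  M = conj_trmx sigma M.

Definition cst_mx (K : fieldType) (m p q : nat) (M : 'M[K]_(p, q)) :
    'M[{mpoly K[m]}]_(p, q) :=
  map_mx (@mpolyC m K) M.

Definition pencil_diag (K : fieldType) (sigma : {rmorphism K -> K})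
    (n m : nat) (V : 'M[K]_(n, m)) (W : 'M[K]_n) : 'M[{mpoly K[m]}]_n :=
  cst_mx m V *m diag_mx (\row_(i < m) 'X_i) *m cst_mx m (conj_trmx sigma V)
  + cst_mx m W.

Definition pencil_sum (K : fieldType) (sigma : {rmorphism K -> K})
    (n m : nat) (V : 'M[K]_(n, m)) (W : 'M[K]_n) : 'M[{mpoly K[m]}]_n :=
  \sum_(i < m) 'X_i *: cst_mx m (col i V *m conj_trmx sigma (col i V))
  + cst_mx m W.

Definition hermitian_det_rep (K : fieldType) (sigma : {rmorphism K -> K})
    (m : nat) (f : {mpoly K[m]}) (n : nat) : Prop :=
  exists (lambda : K) (V : 'M[K]_(n, m)) (W : 'M[K]_n),
    [/\ lambda \in fixed_field sigma,
        hermitian_mx sigma W,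
        f = lambda *: \det (pencil_diag sigma V W)
      & f = lambda *: \det (pencil_sum sigma V W)].

(* msize f = deg f + 1 for f != 0, and msize 0 = 0; thus mpdeg 0 = 0. *)
Definition mpdeg (K : fieldType) (m : nat) (f : {mpoly K[m]}) : nat :=
  (msize f).-1.

(* Main.v *)
Require Import Defs.
From Stdlib Require Import Classical_Prop.
From HB Require Import structures.
From mathcomp Require Import all_boot all_order all_algebra.
From mathcomp Require Import fingroup perm.
From mathcomp Require Import mpoly.
From mathcomp Require Import ring zify.

(* Inverting the variables outside the support of a monomial of maximal degree  *)
(* reduces the existence of a representation to the case where [f] has leading  *)
(* monomial [x_1 ... x_m]; then [f = \det (diag x + A)] means that the          *)
(* coefficients of [f] are the principal minors of [A].  Treating [x_n] as a    *)
(* constant [y], by induction there is a Hermitian [B] over [K(y)] with the     *)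
(* principal minors of a Schur complement [A' - v v^* / y], but [B] itself need *)
(* not have this shape.  Its principal minors have no pole except a simple one  *)
(* at [y = 0].  If all principal minors of a matrix are integral at a prime     *)
(* [p], so are its cyclic products (by induction on the length of the cycle),   *)
(* and a shortest path potential yields a diagonal conjugation by powers of [p] *)
(* that makes the matrix integral.  If the conjugate [p'] is not associated to  *)
(* [p], conjugating by powers of [p / p'] does this for [p] and [p'] at once    *)
(* and keeps the matrix Hermitian; otherwise the entries are already integral,  *)
(* since their norms are.  So [y B] may be assumed to be a polynomial           *)
(* [A' y + C], where [C] has rank one, and [C = - v v^*] since a Rayleigh       *)
(* difference of [f] makes its diagonal entries negatives of norms.             *)
(* Conversely, for [f = \lambda \det M] the adjugate identity for [2 x 2]       *)
(* minors writes the Rayleigh difference as the Hermitian square of             *)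
(* [\lambda v_i^* (\adj M) v_j].                                                *)

Set Implicit Arguments.
Unset Strict Implicit.
Unset Printing Implicit Defensive.

Import GRing.Theory.
Local Open Scope ring_scope.

(** * Principal minors and multiaffine forms *)

(** The core of sufficiency is [hermitian_of_principal_minors]: a Hermitian matrix can be recovered
    from its prescribed principal minors as soon as the Rayleigh differences of their generating
    form are norms at all fixed points. The hypothesis on [f] is a polynomial identity, so it yields
    norms over every extension field, including points at infinity ([rayleigh_norm_point]). In this
    form it survives the adjunction of an indeterminate [y] ([schur_rayleigh_norms]), and an
    induction on the number of indices becomes possible. The difficulty is that the matrix over
    [K(y)] given by induction may have poles that its principal minors do not show.
    [polynomial_scaling] removes them by unitary diagonal conjugations, one irreducible factor at a
    time; [cycle_in_subring] and [exists_potential] supply the exponents. A degree count leaves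
    [A y + C] with [C] of rank one ([schur_complement_split]), and the vector that spans [C] becomes
    a new row and column ([border_minors]). The size [deg f] comes from a set [S] carrying a
    monomial of maximal degree: after inversion of the variables outside [S], the block of the
    matrix outside [S] vanishes, and [det_rep_of_minors] folds the rest into a pencil of size
    [#|S|]. Necessity is an identity for rank-two updates of a determinant, [det_rank_two]. *)

(** Rows outside [U] become rows of the identity, so that the minor is a full-size determinant and
    all minors share the index type ['I_m]. *)
Definition pminor_mx (R : pzRingType) m (A : 'M[R]_m) (U : {set 'I_m}) : 'M[R]_m :=
  \matrix_(i, j) if i \in U then A i j else (i == j)%:R.

Definition pminor (R : pzRingType) m (A : 'M[R]_m) (U : {set 'I_m}) : R :=
  \det (pminor_mx A U).

(* The multihomogeneous form of [\sum_U a U \prod_(i in U) x_i], evaluated at   *)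
(* points [(w i false : w i true)] of the projective line.                      *)
Definition maform (R : pzRingType) m (a : {set 'I_m} -> R)
    (w : 'I_m -> bool -> R) : R :=
  \sum_(U : {set 'I_m}) a U * \prod_i w i (i \in U).

(** Each row is a sum of two rows; in the multilinear expansion, [U] is the set of rows that take
    their summand from [A]. *)
Lemma det_maform (R : comPzRingType) m (A : 'M[R]_m) (u t : 'I_m -> R) :
  \det (\matrix_(i, j) (u i * (i == j)%:R + t i * A i j)) =
  maform (pminor A) (fun i b => if b then t i else u i).
Proof.
rewrite /maform /determinant.
under [RHS]eq_bigr => U _ do rewrite /pminor /determinant big_distrl /=.
rewrite exchange_big; apply: eq_bigr => s _ /=.
under eq_bigr => i _ do rewrite mxE addrC.
rewrite bigA_distr big_distrr /=; apply: eq_bigr => U _.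
rewrite -mulrA -big_split /=; congr (_ * _); apply: eq_bigr => i _.
by rewrite mxE; case: ifP => _; rewrite mulrC.
Qed.

(** A permutation that moves an index outside [U] contributes zero on both sides; any other one maps
    [U] to itself and sees only entries of the block. *)
Lemma eq_pminor (R : comPzRingType) m (A B : 'M[R]_m) (U : {set 'I_m}) :
  {in U &, forall i j, A i j = B i j} -> pminor A U = pminor B U.
Proof.
move=> eqAB; apply: eq_bigr => s _; congr (_ * _).
have [fixU | /forallPn[i]] := boolP [forall i, (i \notin U) ==> (s i == i)].
  apply: eq_bigr => i _; rewrite !mxE; case: ifP => // Ui; apply: eqAB => //.
  apply: contraT => Us; have /forallP/(_ (s i)) := fixU.
  by rewrite Us => /eqP/perm_inj eqs; rewrite eqs Ui in Us.
rewrite negb_imply => /andP[/negPf nUi]; rewrite eq_sym => /negPf nsi.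
by rewrite (bigD1 i) //= [RHS](bigD1 i) //= !mxE nUi nsi !mul0r.
Qed.

Lemma map_pminor (R S : comPzRingType) (f : {rmorphism R -> S}) m (A : 'M[R]_m) (U : {set 'I_m}) :
  pminor (map_mx f A) U = f (pminor A U).
Proof.
rewrite /pminor -det_map_mx; congr (\det _); apply/matrixP => i j.
by rewrite !mxE; case: ifP => // _; rewrite rmorph_nat.
Qed.

Lemma pminor0 (R : comPzRingType) m (A : 'M[R]_m) : pminor A set0 = 1.
Proof.
by rewrite /pminor -[RHS](det1 R m); congr (\det _); apply/matrixP => i j; rewrite !mxE inE.
Qed.

Lemma pminorT (R : comPzRingType) m (A : 'M[R]_m) : pminor A setT = \det A.
Proof. by congr (\det _); apply/matrixP => i j; rewrite mxE inE. Qed.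

Lemma pminor_row0 (R : comPzRingType) m (A : 'M[R]_m) (U : {set 'I_m}) i :
  i \in U -> (forall j, A i j = 0) -> pminor A U = 0.
Proof.
move=> Ui Ai0; rewrite /pminor (expand_det_row _ i) big1 // => j _.
by rewrite mxE Ui Ai0 mul0r.
Qed.

Lemma pminorZ (R : comPzRingType) m c (A : 'M[R]_m) (U : {set 'I_m}) :
  pminor (c *: A) U = c ^+ #|U| * pminor A U.
Proof.
rewrite /pminor -[c ^+ _]prodr_const big_mkcond /=.
pose d : 'rV[R]_m := \row_i (if i \in U then c else 1).
transitivity (\det (diag_mx d *m pminor_mx A U)).
  congr (\det _); apply/matrixP => i j.
  by rewrite mul_diag_mx !mxE; case: ifP => _; rewrite ?mul1r.
by rewrite det_mulmx det_diag; congr (_ * _); apply: eq_bigr => i _; rewrite mxE.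
Qed.

Lemma pminor_scale (F : fieldType) m (d : 'I_m -> F) (A : 'M[F]_m) (U : {set 'I_m}) :
  (forall i, d i != 0) ->
  pminor (\matrix_(i, j) (d i * A i j / d j)) U = pminor A U.
Proof.
move=> nz; pose D (e : 'I_m -> F) := diag_mx (\row_i e i).
have DD : D d *m D (fun i => (d i)^-1) = 1%:M.
  by rewrite mulmx_diag; apply/matrixP => i j; rewrite !mxE divff.
rewrite /pminor -[RHS]mul1r -(det1 F m) -DD det_mulmx mulrAC -!det_mulmx.
congr (\det _); apply/matrixP => i j.
rewrite mul_mx_diag mul_diag_mx !mxE; case: ifP => // _.
by case: eqP => [->|_]; rewrite ?mulr0 ?mul0r // mulr1 divff.
Qed.

Lemma det_unit_row (R : comPzRingType) m (M : 'M[R]_m) (n : 'I_m) (c : R) :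
  (forall j, M n j = c * (n == j)%:R) -> \det M = c * cofactor M n n.
Proof.
move=> Mn; rewrite (expand_det_row _ n) (bigD1 n) //= big1 ?addr0.
  by rewrite Mn eqxx mulr1.
by move=> j ne; rewrite Mn eq_sym (negPf ne) mulr0 mul0r.
Qed.

Lemma det_unit_col (R : comPzRingType) m (M : 'M[R]_m) (n : 'I_m) (c : R) :
  (forall i, M i n = c * (n == i)%:R) -> \det M = c * cofactor M n n.
Proof.
move=> Mn; rewrite (expand_det_col _ n) (bigD1 n) //= big1 ?addr0.
  by rewrite Mn eqxx mulr1.
by move=> i ne; rewrite Mn eq_sym (negPf ne) mulr0 mul0r.
Qed.

Lemma eq_cofactor (R : comPzRingType) m (M N : 'M[R]_m) n :
  (forall i j, i != n -> j != n -> M i j = N i j) ->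
  cofactor M n n = cofactor N n n.
Proof.
move=> eqMN; rewrite /cofactor; congr (_ * \det _); apply/matrixP => i j.
by rewrite !mxE eqMN // eq_sym neq_lift.
Qed.

Lemma cofactor1 (R : comPzRingType) m (n : 'I_m) : cofactor (1%:M : 'M[R]_m) n n = 1.
Proof.
rewrite /cofactor -signr_odd addnn odd_double expr0 mul1r -[RHS](det1 R m.-1).
congr (\det _); apply/matrixP => i j; rewrite !mxE.
by rewrite (inj_eq (@lift_inj _ n)).
Qed.

(** Left multiplication by [L], of determinant 1, subtracts multiples of row [n] from the rows in
    [U] and clears column [n] above and below the pivot. *)
Lemma pminor_schur (F : fieldType) m (M : 'M[F]_m) (n : 'I_m) (U : {set 'I_m}) :
  n \notin U -> M n n != 0 ->
  pminor M (n |: U) =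
  M n n * pminor (\matrix_(i, j) (M i j - M i n * M n j / M n n)) U.
Proof.
move=> nU nz; set B := (\matrix_(i, j) _ : 'M_m).
pose L : 'M[F]_m := \matrix_(i, j) ((i == j)%:R -
  (if i \in U then M i n / M n n else 0) * (n == j)%:R).
have detL : \det L = 1.
  rewrite (@det_unit_row _ _ _ n 1) => [|j]; last by rewrite mxE (negPf nU) mul0r subr0 mul1r.
  rewrite mul1r -[RHS](@cofactor1 F m n); apply: eq_cofactor => i j _ ne.
  by rewrite !mxE eq_sym [n == j]eq_sym (negPf ne) mulr0 subr0.
have LE i j : (L *m pminor_mx M (n |: U)) i j =
    pminor_mx M (n |: U) i j - (if i \in U then M i n / M n n * M n j else 0).
  rewrite mxE (bigD1 i) //=; have [->|ne] := eqVneq i n.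
    rewrite big1 => [|k nek]; last by rewrite mxE (negPf nU) mul0r subr0 eq_sym (negPf nek) mul0r.
    by rewrite !mxE (negPf nU) !eqxx mul0r !subr0 mul1r addr0.
  rewrite (bigD1 n) 1?eq_sym //= big1 ?addr0 => [|k /andP[nei nen]].
    rewrite !mxE eqxx (negPf ne) !inE eqxx /= [n == i]eq_sym (negPf ne) mulr0 subr0 mul1r.
    by rewrite sub0r mulr1 mulNr; case: (i \in U) => //; rewrite mul0r.
  by rewrite !mxE eq_sym (negPf nei) [n == k]eq_sym (negPf nen) mulr0 subr0 mul0r.
rewrite {1}/pminor -[LHS]mul1r -detL -det_mulmx.
rewrite (@det_unit_col _ _ _ n (M n n)) => [|i].
  congr (_ * _); rewrite /pminor (@det_unit_row _ _ (pminor_mx B U) n 1) => [|j]; last first.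
    by rewrite mxE (negPf nU) mul1r.
  rewrite mul1r; apply: eq_cofactor => i j ni nj; rewrite LE !mxE !inE (negPf ni) /=.
  by case: ifP => _; rewrite ?subr0 // mulrAC.
rewrite LE mxE !inE; have [->|ne] := eqVneq i n.
  by rewrite (negPf nU) subr0 mulr1.
rewrite /= mulr0; case: ifP => _; last by rewrite subrr.
by rewrite divfK ?subrr.
Qed.

Lemma pminorD_diag (R : comNzRingType) m (A : 'M[R]_m) (n : 'I_m) (t : R) (U : {set 'I_m}) :
  n \notin U ->
  pminor (A + t *: delta_mx n n) (n |: U) = pminor A (n |: U) + t * pminor A U.
Proof.
move=> nU; rewrite /pminor -[X in _ = X + _]mul1r.
apply: (@determinant_multilinear _ _ _ _ _ n).
- apply/rowP => j; rewrite !mxE !inE eqxx (negPf nU) mul1r /=.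
  by rewrite [j == n]eq_sym.
- apply/matrixP => i j; rewrite !mxE !inE [_ == n]eq_sym (negPf (neq_lift _ _)) /=.
  by rewrite mulr0 addr0.
- apply/matrixP => i j; rewrite !mxE !inE [_ == n]eq_sym (negPf (neq_lift _ _)) /=.
  by rewrite mulr0 addr0.
Qed.

Lemma pminor1 (R : comNzRingType) m (A : 'M[R]_m) i : pminor A [set i] = A i i.
Proof.
rewrite /pminor (expand_det_col _ i) (bigD1 i) //=.
rewrite big1 ?addr0; last by move=> k ne; rewrite !mxE !inE (negPf ne) mul0r.
rewrite !mxE set11 -[RHS]mulr1; congr (_ * _).
rewrite -[RHS](@cofactor1 R m i); apply: eq_cofactor => k l nk nl.
by rewrite !mxE inE (negPf nk).
Qed.

(** Either [x] is a permutation, and the submatrix is a conjugate of [A], or some index [k] is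
    missed by [x] and its row and column can be deleted. *)
Lemma det_mxsub_pminor (R : comNzRingType) s m (x : 'I_s -> 'I_m) (A : 'M[R]_m) :
  injective x -> \det (mxsub x x A) = pminor A [set x k | k : 'I_s].
Proof.
elim: m x A => [|m IHm] x A xI.
  have s0 : s = 0%N by case: s x {xI} => // s x; case: (x ord0).
  by subst s; rewrite /pminor !det_mx00.
have [/forallP xT | /forallPn[k kx]] := boolP [forall k, k \in [set x k | k : 'I_s]].
  have sE : s = m.+1.
    rewrite -[s]card_ord -[m.+1]card_ord -(card_imset _ xI).
    by apply: eq_card => k; rewrite xT.
  subst s; pose p := perm xI.
  have -> : mxsub x x A = perm_mx p *m A *m perm_mx p^-1%g.
    by rewrite -row_permE -col_permE; apply/matrixP => i j; rewrite !mxE !permE.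
  rewrite !det_mulmx !det_perm mulrAC -signr_addb odd_permV addbb mul1r.
  by congr (\det _); apply/matrixP => i j; rewrite !mxE xT.
have ne j : k != x j by apply: contraNneq kx => ->; apply: imset_f.
have /fin_all_exists[x' xE] j : exists y, x j = lift k y.
  by case: (unlift_some (ne j)) => y -> _; exists y.
have x'I : injective x' by move=> i j eqx; apply: xI; rewrite !xE eqx.
have -> : mxsub x x A = mxsub x' x' (row' k (col' k A)).
  by apply/matrixP => i j; rewrite !mxE !xE.
rewrite IHm // [RHS](@det_unit_row _ _ _ k 1) => [|j]; last by rewrite mxE (negPf kx) mul1r.
rewrite mul1r /cofactor -signr_odd addnn odd_double mul1r.
congr (\det _); apply/matrixP => i j; rewrite !mxE.
have -> : (lift k i \in [set x k0 | k0 : 'I_s]) = (i \in [set x' k0 | k0 : 'I_s]).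
  apply/imsetP/imsetP => -[y _]; first by rewrite xE => /lift_inj ->; exists y.
  by move=> ->; exists y.
by rewrite (inj_eq (@lift_inj _ k)).
Qed.

Lemma det_mx22 (R : comNzRingType) (M : 'M[R]_2) :
  \det M = M 0 0 * M 1 1 - M 0 1 * M 1 0.
Proof.
rewrite (expand_det_row _ ord0) !big_ord_recl big_ord0 addr0 /cofactor !det_mx11 !mxE /=.
rewrite !expr0 expr1 mul1r mulN1r mulrN.
by congr (M _ _ * M _ _ - M _ _ * M _ _); apply: val_inj.
Qed.

Lemma pminor2 (R : comNzRingType) m (A : 'M[R]_m) (i j : 'I_m) : i != j ->
  pminor A [set i; j] = A i i * A j j - A i j * A j i.
Proof.
move=> ne; pose x (k : 'I_2) := if k == 0 then i else j.
have xI : injective x.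
  move=> [[|[|?]] ?] [[|[|?]] ?]; rewrite /x //= => e; apply: val_inj => //=;
    by move: ne; rewrite e eqxx.
rewrite -[RHS](_ : \det (mxsub x x A) = _); last by rewrite det_mx22 !mxE.
rewrite det_mxsub_pminor //; congr (pminor A _); apply/setP => k; rewrite !inE.
apply/idP/imsetP => [/orP[]/eqP->|[y _ ->]]; [by exists 0|by exists 1|].
by rewrite /x; case: ifP => _; rewrite eqxx ?orbT.
Qed.

(** * Cyclic products and diagonal scaling over a valuation ring *)

Lemma perm_id_of_le s (g : 'S_s) : (forall i, (g i <= i)%N) -> g = 1%g.
Proof.
move=> gle; apply/permP => i; rewrite perm1.
have [n] := ubnP (val i); elim: n i => // n IHn i lein.
have := gle i; rewrite leq_eqVlt => /orP[/eqP/val_inj // | lt].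
have /perm_inj eqi : g (g i) = g i by apply: IHn; apply: leq_trans lt _.
by rewrite eqi ltnn in lt.
Qed.

Section ValuationSubring.
Variables (L : fieldType) (O : L -> Prop).
Hypotheses (O1 : O 1) (ON : forall x, O x -> O (- x))
  (OD : forall x y, O x -> O y -> O (x + y))
  (OM : forall x y, O x -> O y -> O (x * y))
  (OV : forall x, O x \/ (x != 0 /\ O x^-1)).

Let O0 : O 0. Proof. by rewrite -(subrr 1); apply/OD/ON. Qed.

Let Osign n x : O x -> O ((-1) ^+ n * x).
Proof. by rewrite -signr_odd; case: odd => Ox; rewrite ?mulN1r ?mul1r //; apply: ON. Qed.

Let Osum (I : Type) (r : seq I) (P : pred I) F :
  (forall i, P i -> O (F i)) -> O (\sum_(i <- r | P i) F i).
Proof. by move=> OF; apply: big_ind. Qed.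

Let Oprod (I : Type) (r : seq I) (P : pred I) F :
  (forall i, P i -> O (F i)) -> O (\prod_(i <- r | P i) F i).
Proof. by move=> OF; apply: big_ind. Qed.

Let Odet n (M : 'M[L]_n) : (forall i j, O (M i j)) -> O (\det M).
Proof. by move=> OMx; apply: Osum => s _; apply/Osign/Oprod. Qed.

(** Modulo [t^-1] the matrix is lower unitriangular: every permutation other than the identity picks
    an entry above the diagonal, hence a factor in [t^-1 O]. *)
Lemma det_unitri_mod n (N : 'M[L]_n) (t : L) : O t^-1 -> t != 0 ->
  (forall i, N i i = 1) -> (forall i j : 'I_n, (j < i)%N -> O (N i j)) ->
  (forall i j : 'I_n, (i < j)%N -> O (t * N i j)) -> O (t * (\det N - 1)).
Proof.
move=> Ot t0 N1 Nl Nu.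
have ONij i j : O (N i j).
  have [lt|lt|/val_inj ->] := ltngtP i j; [|exact: Nl|by rewrite N1].
  by rewrite -[N i j](mulKf t0); apply/OM/Nu.
rewrite /determinant (bigD1 1%g) //= odd_perm1 expr0 mul1r big1 => [|i _]; last by rewrite perm1.
rewrite [1 + _]addrC addrK mulr_sumr; apply: Osum => s s1.
have [i lti] : exists i : 'I_n, (i < s i)%N.
  apply/existsP; apply: contra_neqT s1 => /existsPn s1.
  by apply: perm_id_of_le => i; rewrite leqNgt.
rewrite mulrCA (bigD1 i) //= [t * _]mulrA; apply: Osign; apply: OM; first exact: Nu.
exact: Oprod.
Qed.

(* Scale the matrix so that all entries along a shortest cycle with product [t] *)
(* outside the subring are [1], except for the last one.  The cofactor of that  *)
(* entry is then unitriangular modulo [t^-1], so that the determinant is [t] up *)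
(* to sign plus an element of the subring.                                      *)
Lemma cycle_in_subring s m (A : 'M[L]_m) (x : nat -> 'I_m) :
  (forall U, O (pminor A U)) -> {in [pred k | (k <= s)%N] &, injective x} ->
  O ((\prod_(0 <= k < s) A (x k) (x k.+1)) * A (x s) (x 0%N)).
Proof.
move=> OA; have [r] := ubnP s; elim: r s x => // r IHr s x lesr xI.
have {IHr} IHs k y : (k < s)%N -> {in [pred k0 | (k0 <= k)%N] &, injective y} ->
    O ((\prod_(0 <= k0 < k) A (y k0) (y k0.+1)) * A (y k) (y 0%N)).
  by move=> ltks; apply: IHr; lia.
pose d a := \prod_(0 <= k < a) A (x k) (x k.+1).
have [ds0 | dsN0] := eqVneq (d s) 0; first by rewrite -/(d s) ds0 mul0r.
have dS a b : (a <= b)%N -> d b = d a * \prod_(a <= k < b) A (x k) (x k.+1).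
  by move=> leab; rewrite /d (big_cat_nat _ leab).
have dN0 a : (a <= s)%N -> d a != 0.
  by move=> /dS dsE; apply: contraNneq dsN0 => da0; rewrite dsE da0 mul0r.
have dB a b : (a <= b <= s)%N -> \prod_(a <= k < b) A (x k) (x k.+1) = d b / d a.
  by case/andP=> leab lebs; rewrite (dS a b) // mulrC mulKf // dN0 // (leq_trans leab).
pose F a b := d a * A (x a) (x b) / d b.
set t := _ * _; have tE : F s 0%N = t by rewrite /F /d big_nil divr1.
have F1 a : (a < s)%N -> F a a.+1 = 1.
  move=> lt; have dSr : d a * A (x a) (x a.+1) = d a.+1 by rewrite /d big_nat_recr.
  by rewrite /F dSr divff ?dN0.
(* On and below the diagonal, [F a b] is the product along the shorter cycle from [x b] through
   [x a] back to [x b]. *)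
have Fl a b : (b <= a <= s)%N -> (a - b < s)%N -> O (F a b).
  case/andP=> leba leas lt.
  have yI : {in [pred k | (k <= a - b)%N] &, injective (fun k => x (b + k)%N)}.
    by move=> k l; rewrite !inE => lek lel /xI; rewrite !inE; lia.
  have := IHs _ _ lt yI; rewrite addn0 subnKC //; congr (O _); rewrite /F mulrAC; congr (_ * _).
  rewrite -dB ?leba // -[in RHS](add0n b) big_addn.
  by apply: eq_big_nat => k _; rewrite !(addnC b) addSn.
(* Above the superdiagonal, [t * F a b] is the product along the cycle that jumps from [x a]
   straight to [x b]; [y] enumerates this shortened cycle. *)
have Fu a b : (a.+1 < b <= s)%N -> O (t * F a b).
  case/andP=> ltab lebs; have ltab' := ltnW ltab; pose y k := x (if (k <= a)%N then k else (k +
    (b - a.+1))%N).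
  have yI : {in [pred k | (k <= s - (b - a.+1))%N] &, injective y}.
    by move=> k l; rewrite !inE /y => lek lel /xI; rewrite !inE; case: ifP; case: ifP; lia.
  have lt : (s - (b - a.+1) < s)%N by lia.
  have := IHs _ _ lt yI; congr (O _); rewrite (@big_cat_nat _ _ _ a) //=; last by lia.
  have yl k : (k <= a)%N -> y k = x k by rewrite /y => ->.
  have yr k : (a < k)%N -> y k = x (k + (b - a.+1))%N by rewrite /y ltnNge => /negPf ->.
  have ltas : (a < s - (b - a.+1))%N by lia.
  have -> : \prod_(0 <= k < a) A (y k) (y k.+1) = d a.
    by apply: eq_big_nat => k ltk; rewrite !yl //; lia.
  rewrite (big_ltn ltas) /=.
  have -> : \prod_(a.+1 <= k < s - (b - a.+1)) A (y k) (y k.+1) = d s / d b.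
    rewrite -dB ?lebs ?leqnn // -[in RHS](subnKC ltab') big_addn.
    by apply: eq_big_nat => k ltk; rewrite !yr //; lia.
  have -> : y a.+1 = x b by rewrite yr //; congr x; lia.
  have -> : y (s - (b - a.+1))%N = x s by rewrite yr //; congr x; lia.
  rewrite (yl a) // (yl 0%N) // /t /F -/(d s).
  by ring.
(* In the remaining case [t^-1] lies in [O], and then every entry of [M] lies in [O] except possibly
   the corner [t]. *)
case: (OV t) => // -[t0 Ot].
pose M : 'M[L]_s.+1 := \matrix_(i, j) F i j.
have OFu a b : (a.+1 < b <= s)%N -> O (F a b).
  by move=> /Fu; rewrite -{2}[F a b](mulKf t0) => /(OM Ot).
have OF a b : (a <= s)%N -> (b <= s)%N -> (a, b) != (s, 0%N) -> O (F a b).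
  move=> leas lebs neab; have [leba|ltab] := leqP b a.
    by apply: Fl; [rewrite leba|move: neab; rewrite xpair_eqE; lia].
  have [<-|neb] := eqVneq a.+1 b; last by apply: OFu; lia.
  by rewrite F1 //; lia.
have OdetM : O (\det M).
  pose xo (i : 'I_s.+1) := x i.
  have xoI : injective xo by move=> i j /xI eqij; apply/val_inj/eqij; rewrite inE -ltnS.
  have -> : M = \matrix_(i, j) (d i * mxsub xo xo A i j / d j) by apply/matrixP => i j; rewrite
    !mxE.
  have dI (i : 'I_s.+1) : d i != 0 by apply: dN0; rewrite -ltnS.
  have := @pminor_scale _ _ (fun i : 'I_s.+1 => d i) (mxsub xo xo A) setT dI.
  by rewrite !pminorT => ->; rewrite det_mxsub_pminor.
have OMij (i j : 'I_s.+1) : ((i : nat), (j : nat)) != (s, 0%N) -> O (M i j).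
  by move=> ne; rewrite mxE; apply: OF; rewrite // -ltnS.
have Ocof j : O (cofactor M ord_max j).
  rewrite /cofactor; apply: Osign; apply: Odet => k l; rewrite !mxE.
  apply: OF; rewrite -?[(_ <= s)%N]ltnS ?ltn_ord //.
  have /= ltk := ltn_ord k.
  by rewrite xpair_eqE /= /bump leqNgt ltk add0n ltn_eqF.
have : O (t * cofactor M ord_max ord0).
  have <- : \det M - \sum_(j | j != ord0) M ord_max j * cofactor M ord_max j = t * cofactor M
    ord_max ord0.
    by rewrite (expand_det_row _ ord_max) (bigD1 ord0) //= addrK mxE /= tE.
  apply/OD/ON/Osum => // j ne; apply: OM => //; apply: OMij.
  by apply: contra ne => /eqP[/eqP].
(* Deleting the last row and first column shifts the superdiagonal of ones onto the diagonal of [N].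
   Both [t * \det N] and [t * (\det N - 1)] lie in [O], hence so does [t]. *)
pose N : 'M[L]_s := \matrix_(i, j) F i j.+1.
have -> : cofactor M ord_max ord0 = (-1) ^+ s * \det N.
  rewrite /cofactor addn0; congr (_ * \det _); apply/matrixP => i j.
  by rewrite !mxE /= /bump leqNgt ltn_ord.
rewrite mulrCA => /(Osign s); rewrite signrMK => OtN.
have := @det_unitri_mod s N t Ot t0.
have N1 i : N i i = 1 by rewrite mxE F1.
have Nl (i j : 'I_s) : (j < i)%N -> O (N i j).
  by move=> lt; rewrite mxE; apply: Fl; have := ltn_ord i; lia.
have Nu (i j : 'I_s) : (i < j)%N -> O (t * N i j).
  by move=> lt; rewrite mxE; apply: Fu; have := ltn_ord j; lia.
move=> /(_ N1 Nl Nu)/ON; rewrite mulrBr mulr1 opprB => OtN'.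
by rewrite -(subrK (t * \det N) t); apply: OD.
Qed.
End ValuationSubring.

(** * Shortest path potentials on a finite graph *)

Section Potential.
Variables (T : finType) (E : rel T) (w : T -> T -> int).

(* The list [s] is a path ending at [j], read backwards. *)
Fixpoint back_weight (j : T) (s : seq T) : int :=
  if s is i :: s' then back_weight i s' + w i j else 0.

Let back_path (j : T) (s : seq T) := path (fun j i => E i j) j s.

Lemma back_weight_drop i0 j s r : (r <= size s)%N ->
  back_weight j s = back_weight (nth i0 (j :: s) r) (drop r s)
    + \sum_(0 <= k < r) w (nth i0 (j :: s) k.+1) (nth i0 (j :: s) k).
Proof.
elim: s j r => [|i s IHs] j [|r] //=; rewrite ?big_nil ?addr0 //.
move=> /IHs ->; rewrite big_nat_recl // -addrA; congr (_ + _).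
by rewrite addrC.
Qed.

(** The potential at [j] is the least weight of a simple path ending at [j], from any starting
    point; appending the edge from [i] to [j] to an optimal path ending at [i] gives the
    inequality. *)
Lemma exists_potential :
  (forall s (x : nat -> T), {in [pred k | (k <= s)%N] &, injective x} ->
    (forall k, (k < s)%N -> E (x k) (x k.+1)) -> E (x s) (x 0%N) ->
    0 <= (\sum_(0 <= k < s) w (x k) (x k.+1)) + w (x s) (x 0%N)) ->
  exists e : T -> int, forall i j, E i j -> 0 <= w i j + e i - e j.
Proof.
move=> cycle_ge0.
pose simple j (s : {bseq #|T| of T}) := back_path j s && uniq (j :: s).
have nil_simple j : simple j [bseq] by rewrite /simple /back_path.
pose opt j := [arg min_(s < [bseq] | simple j s) back_weight j s]%O.
have optP j : simple j (opt j) /\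
    forall s, simple j s -> back_weight j (opt j) <= back_weight j s.
  by rewrite /opt; case: Order.TotalTheory.arg_minP => // s sj smin; split.
exists (fun j => back_weight j (opt j)) => i j Eij.
have [/andP[pi ui] _] := optP i; have [_ minj] := optP j.
suff : back_weight j (opt j) <= back_weight i (opt i) + w i j by lia.
have [ji | nji] := boolP (j \in i :: opt i); last first.
  have sz : (size (i :: opt i) <= #|T|)%N.
    by rewrite -(card_uniqP ui) max_card.
  apply: (minj (Bseq sz)); apply/andP; split; first by apply/andP; split.
  by rewrite cons_uniq nji.
(* Here [j] already lies on the optimal path to [i]. The part from [j] to [i], closed by the edge
   from [i] to [j], is a cycle of nonnegative weight, and what precedes it is a simple path ending
   at [j]. *)
set P := i :: opt i in ji ui; pose r := index j P.
have ltr : (r < size P)%N by rewrite index_mem.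
have ler : (r <= size (opt i))%N by [].
have nthr : nth i P r = j by rewrite nth_index.
rewrite (back_weight_drop i i ler) -/P nthr.
have le1 : back_weight j (opt j) <= back_weight j (drop r (opt i)).
  have sz : (size (drop r (opt i)) <= #|T|)%N by rewrite size_drop (leq_trans (leq_subr _ _))
    // size_bseq.
  apply: (minj (Bseq sz)); apply/andP; split; last first.
    have <- : drop r P = j :: drop r (opt i) by rewrite (drop_nth i ltr) nthr.
    exact: drop_uniq.
  have : back_path i (opt i) by [].
  rewrite /back_path -{1}[bseqval (opt i)](cat_take_drop r) cat_path => /andP[_].
  by rewrite (last_nth i) size_takel // -[i :: take _ _]/(take r.+1 P) nth_take // nthr.
pose x k := nth i P (r - k).
have xI : {in [pred k | (k <= r)%N] &, injective x}.
  move=> k l; rewrite !inE => lek lel /eqP; rewrite nth_uniq ?(leq_ltn_trans (leq_subr _ _)) //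
    => /eqP; lia.
have Ex k : (k < r)%N -> E (x k) (x k.+1).
  move=> ltk; have /(pathP i) pP := pi.
  have := pP (r - k.+1)%N; rewrite /x -(subnSK ltk) /=; apply.
  by apply: leq_trans ler; rewrite subnSK // leq_subr.
have x0 : x 0%N = j by rewrite /x subn0.
have xr : x r = i by rewrite /x subnn.
have := cycle_ge0 r x xI Ex; rewrite x0 xr => /(_ Eij).
have -> : \sum_(0 <= k < r) w (x k) (x k.+1) = \sum_(0 <= k < r) w (nth i P k.+1) (nth i P k).
  rewrite [RHS]big_nat_rev; apply: eq_big_nat => k ltk; rewrite /x add0n.
  by congr (w (nth _ _ _) (nth _ _ _)); lia.
lia.
Qed.
End Potential.

(** * Rational functions *)

Local Notation "x %:F" := (@FracField.tofrac _ x).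

Section FractionField.
Variable R : idomainType.

Lemma fracE (x : {fraction R}) :
  x = (\n_(generic_quotient.repr x))%:F / (\d_(generic_quotient.repr x))%:F.
Proof.
set r := generic_quotient.repr x.
have nz : (\d_r)%:F != 0 :> {fraction R} by rewrite tofrac_eq0 denom_ratioP.
apply: (mulIf nz); rewrite divfK //.
rewrite -[x]generic_quotient.reprK -/r; unlock FracField.tofrac.
rewrite -[LHS]FracField.pi_mul; apply/generic_quotient.eqmodP => /=.
rewrite FracField.equivfE /FracField.mulf !numden_Ratio ?mulf_neq0 ?oner_eq0 ?denom_ratioP //.
by rewrite !mulr1 mulrC.
Qed.

Lemma frac_quot (x : {fraction R}) : exists n d : R, d != 0 /\ x = n%:F / d%:F.
Proof. by do 2!eexists; split; last exact: fracE; exact: denom_ratioP. Qed.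
End FractionField.

Section RatFunMap.
Variables (K : fieldType) (sigma : {rmorphism K -> K}).
Local Notation L := {fraction {poly K}}.
Local Notation "p ^-" := (map_poly sigma p) (at level 2, format "p ^-").

(** The extension of [sigma] to [K(y)] that fixes [y]. It is computed on a chosen representative;
    [ratfun_map_div] shows that the choice is immaterial. *)
Definition ratfun_map (x : L) : L :=
  (\n_(generic_quotient.repr x))^- %:F / (\d_(generic_quotient.repr x))^- %:F.

Lemma ratfun_map_div (n d : {poly K}) : d != 0 ->
  ratfun_map (n%:F / d%:F) = n^- %:F / d^- %:F.
Proof.
move=> dN0; rewrite /ratfun_map.
set r := generic_quotient.repr _.
have rN0 : \d_r != 0 by exact: denom_ratioP.
have mapN0 (q : {poly K}) : q != 0 -> q^- %:F != 0 :> L.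
  by rewrite tofrac_eq0 map_poly_eq0.
have FN0 (q : {poly K}) : q != 0 -> q%:F != 0 :> L by rewrite tofrac_eq0.
apply/eqP; rewrite eqr_div ?mapN0 // -!tofracM tofrac_eq -!rmorphM /=.
apply/eqP; congr (_^-); apply/eqP; rewrite -tofrac_eq !tofracM.
by rewrite -eqr_div ?FN0 // -fracE.
Qed.

Lemma ratfun_map_tofrac (p : {poly K}) : ratfun_map p%:F = p^- %:F.
Proof.
by rewrite -[p%:F]divr1 -tofrac1 ratfun_map_div ?oner_eq0 // rmorph1 tofrac1 divr1.
Qed.

Let mapN0 (q : {poly K}) : q != 0 -> q^- %:F != 0 :> L.
Proof. by rewrite tofrac_eq0 map_poly_eq0. Qed.

Let FN0 (q : {poly K}) : q != 0 -> q%:F != 0 :> L.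
Proof. by rewrite tofrac_eq0. Qed.

Lemma ratfun_map_is_zmod_morphism : zmod_morphism ratfun_map.
Proof.
move=> x y; have [n [d [dN0 ->]]] := frac_quot x; have [n' [d' [dN0' ->]]] := frac_quot y.
have -> : n%:F / d%:F - n'%:F / d'%:F = (n * d' - n' * d)%:F / (d * d')%:F :> L.
  by rewrite tofracB !tofracM -mulNr addf_div ?FN0 // mulNr.
rewrite !ratfun_map_div ?mulf_neq0 // rmorphB !rmorphM /= tofracB !tofracM.
by rewrite -[in RHS]mulNr addf_div ?mapN0 // mulNr.
Qed.

Lemma ratfun_map_is_monoid_morphism : monoid_morphism ratfun_map.
Proof.
split=> [|x y]; first by rewrite -tofrac1 ratfun_map_tofrac rmorph1.
have [n [d [dN0 ->]]] := frac_quot x; have [n' [d' [dN0' ->]]] := frac_quot y.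
rewrite mulf_div -!tofracM !ratfun_map_div ?mulf_neq0 // !rmorphM /=.
by rewrite mulf_div.
Qed.

HB.instance Definition _ :=
  GRing.isZmodMorphism.Build L L ratfun_map ratfun_map_is_zmod_morphism.
HB.instance Definition _ :=
  GRing.isMonoidMorphism.Build L L ratfun_map ratfun_map_is_monoid_morphism.

Hypothesis sigmaK : involutive sigma.

Lemma map_polyK : involutive (map_poly sigma).
Proof. by move=> p; apply/polyP => i; rewrite !coef_map /= sigmaK. Qed.

Lemma ratfun_mapK : involutive ratfun_map.
Proof.
move=> x; have [n [d [dN0 ->]]] := frac_quot x.
by rewrite (ratfun_map_div n dN0) ratfun_map_div ?map_poly_eq0 // !map_polyK.
Qed.

(** With [z = u / w], evaluate [P w w^- = u u^-] at 0. If [w] vanishes there, so does [u], and a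
    common factor ['X] cancels. *)
Lemma norm_specialize (P : {poly K}) (z : L) :
  P%:F = z * ratfun_map z -> exists c, P.[0] = c * sigma c.
Proof.
have [u [w [wN0 ->]]] := frac_quot z.
rewrite ratfun_map_div // mulf_div => /eqP; rewrite -[P%:F]divr1 eqr_div ?oner_eq0 ?mulf_neq0
  ?FN0 ?map_poly_eq0 //.
rewrite mulr1 -!tofracM tofrac_eq => /eqP.
have at0 (p : {poly K}) : p^-.[0] = sigma p.[0] by rewrite -[in LHS](rmorph0 sigma) horner_map.
have [n] := ubnP (size w); elim: n w u wN0 => // n IHn w u wN0 lew E.
have [w0|w0] := eqVneq w.[0] 0; last first.
  exists (u.[0] / w.[0]); move/(congr1 (horner^~ 0)): E; rewrite !hornerM !at0 => E.
  by rewrite rmorphM fmorphV mulf_div -E mulfK // mulf_neq0 // fmorph_eq0.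
have dvdX (p : {poly K}) : p.[0] = 0 -> exists p1, p = p1 * 'X.
  by move/eqP => /factor_theorem[p1]; rewrite subr0; exists p1.
have [w1 wE] := dvdX w w0.
have u0 : u.[0] = 0.
  move/(congr1 (horner^~ 0)): E; rewrite !hornerM !at0 w0 mul0r mulr0 => /esym/eqP.
  by rewrite mulf_eq0 fmorph_eq0 orbb => /eqP.
have [u1 uE] := dvdX u u0.
have w1N0 : w1 != 0 by apply: contraNneq wN0 => w10; rewrite wE w10 mul0r.
apply: (IHn w1 u1) => //; first by rewrite wE size_mulX // in lew.
apply: (@mulIf _ ('X * 'X)); first by rewrite mulf_neq0 // polyX_eq0.
move: E; rewrite wE uE !rmorphM /= !map_polyX => E; rewrite !mulrA; move: E.
by rewrite !mulrA ![_ * 'X * w1^-]mulrAC ![_ * 'X * u1^-]mulrAC.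
Qed.
End RatFunMap.

Lemma exprz_subn (F : fieldType) (x : F) (k l : nat) : x != 0 ->
  x ^ (k%:Z - l%:Z) = x ^+ k / x ^+ l.
Proof. by move=> xN0; rewrite expfzDr // -exprnN. Qed.

Lemma strip_expfz (F : fieldType) (x u w : F) n : x != 0 -> u != 0 -> w != 0 ->
  (x ^- n.+1) * (u / w) * (x ^+ n * w / u) = x^-1.
Proof.
move=> xN0 uN0 wN0; rewrite exprS; have := expf_neq0 n xN0; move: (x ^+ n) => y yN0.
by field; rewrite xN0 uN0 wN0 yN0.
Qed.

Lemma expfz_mul_frac (F : fieldType) (x a b c d : F) (k l : int) : x != 0 ->
  x ^ k * (a / b) * (x ^ l * (c / d)) = x ^ (k + l) * (a * c / (b * d)).
Proof. by move=> xN0; rewrite mulrACA mulf_div expfzDr. Qed.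

(** * Localization of [K[y]] at an irreducible polynomial *)

Section PAdic.
Variables (K : fieldType) (p : {poly K}).
Hypothesis p_irr : irreducible_poly p.
Local Notation L := {fraction {poly K}}.

Definition p_integral (x : L) : Prop :=
  exists u w : {poly K}, ~~ (p %| w) /\ x = u%:F / w%:F.

Let pF0 : p%:F != 0 :> L. Proof. by rewrite tofrac_eq0 irredp_neq0. Qed.

Let ndvd_neq0 w : ~~ (p %| w) -> w != 0.
Proof. by apply: contraNneq => ->; apply: dvdp0. Qed.

Let ndvdF w : ~~ (p %| w) -> w%:F != 0 :> L.
Proof. by move/ndvd_neq0; rewrite tofrac_eq0. Qed.

Lemma irredp_ndvdM (u w : {poly K}) : ~~ (p %| u) -> ~~ (p %| w) -> ~~ (p %| u * w).
Proof. by move=> pu pw; rewrite Gauss_dvdpr // irreducible_poly_coprime. Qed.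

Lemma p_integral_tofrac (q : {poly K}) : p_integral q%:F.
Proof.
exists q, 1; rewrite tofrac1 divr1; split=> //.
by rewrite dvdp1; case: p_irr => + _; case: ltngtP.
Qed.

Lemma p_integralN x : p_integral x -> p_integral (- x).
Proof. by case=> u [w [pw ->]]; exists (- u), w; rewrite tofracN mulNr. Qed.

Lemma p_integralD x y : p_integral x -> p_integral y -> p_integral (x + y).
Proof.
move=> [u [w [pw ->]]] [u' [w' [pw' ->]]]; exists (u * w' + u' * w), (w * w').
by split; [exact: irredp_ndvdM|rewrite addf_div ?ndvdF // tofracD !tofracM].
Qed.

Lemma p_integralM x y : p_integral x -> p_integral y -> p_integral (x * y).
Proof.
move=> [u [w [pw ->]]] [u' [w' [pw' ->]]]; exists (u * u'), (w * w').
by split; [exact: irredp_ndvdM|rewrite mulf_div !tofracM].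
Qed.

Lemma p_integralV (q : {poly K}) : ~~ (p %| q) -> p_integral (q%:F)^-1.
Proof. by exists 1, q; rewrite tofrac1 mul1r. Qed.

Lemma p_integralXz (q : {poly K}) (k : int) : ~~ (p %| q) -> p_integral (q%:F ^ k).
Proof.
move=> pq; case: k => n; first by have := p_integral_tofrac (q ^+ n); rewrite tofracXn.
rewrite NegzE -exprnN -tofracXn; apply: p_integralV.
elim: n.+1 => [|k IHk]; last by rewrite exprS irredp_ndvdM.
by rewrite expr0 dvdp1; case: p_irr => + _; case: ltngtP.
Qed.

Lemma poly_p_part (q : {poly K}) : q != 0 ->
  exists k q', ~~ (p %| q') /\ q = p ^+ k * q'.
Proof.
have [n] := ubnP (size q); elim: n q => // n IHn q leq qN0.
have [/dvdpP[q1 qE]|pq] := boolP (p %| q); last by exists 0%N, q; rewrite mul1r.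
have q1N0 : q1 != 0 by apply: contraNneq qN0 => q10; rewrite qE q10 mul0r.
have [||k [q' [pq' q1E]]] := IHn q1 => //.
  move: leq; rewrite qE size_mul ?(irredp_neq0 p_irr) // ltnS; apply: leq_trans.
  case: p_irr => p1 _.
  by rewrite -subn1 -addnBA ?(ltnW p1) // -addn1 leq_add2l subn_gt0.
by exists k.+1, q'; split=> //; rewrite qE q1E exprSr mulrAC.
Qed.

Lemma p_adic_decomp (x : L) : x != 0 ->
  exists (k : int) (u w : {poly K}), [/\ ~~ (p %| u), ~~ (p %| w)
    & x = p%:F ^ k * (u%:F / w%:F)].
Proof.
have [n [d [dN0 ->]]] := frac_quot x => xN0.
have nN0 : n != 0 by apply: contraNneq xN0 => ->; rewrite tofrac0 mul0r.
have [k [u [pu ->]]] := poly_p_part nN0; have [l [w [pw ->]]] := poly_p_part dN0.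
exists (k%:Z - l%:Z), u, w; split=> //.
rewrite (exprz_subn _ _ pF0).
by rewrite !tofracM !tofracXn mulf_div.
Qed.

Lemma p_adic_ge0 (k : int) (u w : {poly K}) : ~~ (p %| u) -> ~~ (p %| w) ->
  p_integral (p%:F ^ k * (u%:F / w%:F)) -> 0 <= k.
Proof.
move=> pu pw; case: k => // n pI; suff : p_integral (p%:F)^-1.
  case=> u' [w' [pw' E]]; case/negP: (pw'); apply/dvdpP; exists u'.
  apply/eqP; rewrite -tofrac_eq tofracM -(divfK (ndvdF pw') u'%:F) -E.
  by rewrite mulrAC mulVf // mul1r.
have := p_integralM pI (p_integralM (p_integral_tofrac (p ^+ n * w)) (p_integralV pu)).
congr p_integral; rewrite NegzE -exprnN tofracM tofracXn.
exact: strip_expfz pF0 (ndvdF pu) (ndvdF pw).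
Qed.

Lemma p_integral_or_inv (x : L) : p_integral x \/ (x != 0 /\ p_integral x^-1).
Proof.
have [->|xN0] := eqVneq x 0; first by left; rewrite -tofrac0; apply: p_integral_tofrac.
have [k [u [w [pu pw ->]]]] := p_adic_decomp xN0.
have pk n : p_integral (p%:F ^+ n) by rewrite -tofracXn; apply: p_integral_tofrac.
case: k => n; [left|right]; last split.
- by apply/p_integralM/(p_integralM (p_integral_tofrac u) (p_integralV pw)); apply: pk.
- by [].
- rewrite NegzE -exprnN invfM invrK invf_div.
  by apply/p_integralM/(p_integralM (p_integral_tofrac w) (p_integralV pu)); apply: pk.
Qed.

(** Weigh the edge from [i] to [j] by the valuation of [A i j]. Integrality of cyclic products
    ([cycle_in_subring]) says that cycles have nonnegative weight, and a potential gives the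
    exponents. *)
Lemma p_integral_potential m (A : 'M[L]_m) :
  (forall U, p_integral (pminor A U)) ->
  exists e : 'I_m -> int, forall i j, p_integral (p%:F ^ (e i - e j) * A i j).
Proof.
move=> pA.
(* Zero entries get a dummy valuation; they are not edges of the graph. *)
have /fin_all_exists[v vP] (ij : 'I_m * 'I_m) : exists kuw : int * ({poly K} * {poly K}),
    A ij.1 ij.2 != 0 -> [/\ ~~ (p %| kuw.2.1), ~~ (p %| kuw.2.2) &
      A ij.1 ij.2 = p%:F ^ kuw.1 * (kuw.2.1%:F / kuw.2.2%:F)].
  have [->|/p_adic_decomp[k [u [w uw]]]] := eqVneq (A ij.1 ij.2) 0; last by exists (k, (u, w)).
  by exists (0, (0, 0)).
pose w i j := (v (i, j)).1.
have walk_prod n (x : nat -> 'I_m) : (forall k, (k < n)%N -> A (x k) (x k.+1) != 0) ->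
    exists a b, [/\ ~~ (p %| a), ~~ (p %| b) & \prod_(0 <= k < n) A (x k) (x k.+1) =
      p%:F ^ (\sum_(0 <= k < n) w (x k) (x k.+1)) * (a%:F / b%:F)].
  elim: n => [|n IHn] xE.
    exists 1, 1; rewrite !big_nil expr0z tofrac1 divr1 mulr1; split=> //;
    by rewrite dvdp1; case: p_irr => + _; case: ltngtP.
  have [|a [b [pa pb abE]]] := IHn; first by move=> k ltk; apply: xE; rewrite ltnS ltnW.
  have [pa' pb' vE] := vP (x n, x n.+1) (xE n (ltnSn n)).
  exists (a * (v (x n, x n.+1)).2.1), (b * (v (x n, x n.+1)).2.2).
  split; [exact: irredp_ndvdM|exact: irredp_ndvdM|].
  rewrite !big_nat_recr //= !tofracM abE [X in _ * X]vE.
  exact: expfz_mul_frac.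
have [|e eP] := @exists_potential _ (fun i j => A i j != 0) w.
  move=> s x xI xE xE0.
  have p1 : p_integral 1 by rewrite -tofrac1; apply: p_integral_tofrac.
  have pI := cycle_in_subring p1 p_integralN p_integralD
    p_integralM p_integral_or_inv pA xI.
  have [a [b [pa pb abE]]] := walk_prod s x xE.
  have [pa' pb' vE] := vP (x s, x 0%N) xE0.
  apply: (p_adic_ge0 (u := a * (v (x s, x 0%N)).2.1) (w := b * (v (x s, x 0%N)).2.2)).
  - exact: irredp_ndvdM.
  - exact: irredp_ndvdM.
  - move: pI; rewrite (tofracM a) (tofracM b) abE [X in _ * X]vE.
    by rewrite (expfz_mul_frac _ _ _ _ _ _ pF0).
exists e => i j; have [->|Aij] := eqVneq (A i j) 0.
  by rewrite mulr0 -tofrac0; apply: p_integral_tofrac.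
have [pa pb ->] := vP (i, j) Aij; have := eP i j Aij.
rewrite mulrA -(expfzDr _ _ pF0) -/(w i j) [_ + w i j]addrC [w i j + (_ - _)]addrA.
case: (w i j + e i - e j) => // n _.
apply/p_integralM/(p_integralM (p_integral_tofrac _) (p_integralV pb)).
by have := p_integral_tofrac (p ^+ n); rewrite tofracXn.
Qed.
End PAdic.

(** Over an arbitrary field, the existence of a proper divisor is settled by [classic]; the descent
    is on the size. *)
Lemma irreducible_factor (K : fieldType) (q : {poly K}) : (1 < size q)%N ->
  exists2 p, irreducible_poly p & p %| q.
Proof.
have [n] := ubnP (size q); elim: n q => // n IHn q leq q1.
have [[d [d1 dq dvd]]|nd] := classic (exists d : {poly K},
    [/\ (1 < size d)%N, (size d < size q)%N & d %| q]).
  have [|p p_irr pd] := IHn d _ d1; first exact: leq_trans dq _.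
  by exists p => //; apply: dvdp_trans pd dvd.
exists q => //; split=> // d d1 dvd; have qN0 : q != 0 by rewrite -size_poly_gt0 ltnW.
rewrite -dvdp_size_eqp // eqn_leq dvdp_leq //= leqNgt; apply/negP => lt; apply: nd.
exists d; split=> //; rewrite ltn_neqAle eq_sym d1 size_poly_gt0.
by apply: contraNneq qN0 => d0; rewrite -dvd0p -d0.
Qed.

Lemma ratio_exp_pos (F : fieldType) (a b : F) (n : nat) : b != 0 ->
  a ^+ n * b ^+ n * (a / b) ^ n%:Z = a ^+ n * a ^+ n.
Proof.
by move=> bN0; rewrite -exprnP expr_div_n -mulrA [X in _ * X]mulrC divfK // expf_neq0.
Qed.

Lemma ratio_exp_neg (F : fieldType) (a b : F) (n : nat) : a != 0 -> b != 0 ->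
  a ^+ n.+1 * b ^+ n.+1 * (a / b) ^ Negz n = b ^+ n.+1 * b ^+ n.+1.
Proof.
move=> aN0 bN0; rewrite NegzE -exprnN -exprVn invf_div expr_div_n.
by rewrite mulrC mulrA divfK ?expf_neq0.
Qed.

(** * Removal of denominators by unitary diagonal conjugation *)

Section PolynomialScaling.
Variables (K : fieldType) (sigma : {rmorphism K -> K}).
Hypothesis sigmaK : involutive sigma.
Local Notation L := {fraction {poly K}}.
Local Notation tau := (ratfun_map sigma).
Local Notation "p ^-" := (map_poly sigma p) (at level 2, format "p ^-").

Definition polynomial (x : L) : Prop := exists Q : {poly K}, x = Q%:F.

Lemma polynomialM x y : polynomial x -> polynomial y -> polynomial (x * y).
Proof. by case=> P -> [Q ->]; exists (P * Q); rewrite tofracM. Qed.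

Lemma polynomial_map x : polynomial (tau x) -> polynomial x.
Proof. by case=> Q E; exists Q^-; rewrite -ratfun_map_tofrac -E ratfun_mapK. Qed.

Lemma polynomial_strip (p r : {poly K}) n x : irreducible_poly p -> p_integral p x ->
  polynomial ((p ^+ n * r)%:F * x) -> polynomial (r%:F * x).
Proof.
move=> p_irr [u [w [pw ->]]].
have wN0 : w != 0 by apply: contraNneq pw => ->; apply: dvdp0.
have wF0 : w%:F != 0 :> L by rewrite tofrac_eq0.
elim: n => [|n IHn]; first by rewrite expr0 mul1r.
case=> Q E; apply: IHn.
have {}E : p * (p ^+ n * r * u) = Q * w.
  have := congr1 (fun t => t * w%:F) E; rewrite /= [_ * (_ / _)]mulrA divfK //.
  by rewrite -!tofracM => /eqP; rewrite tofrac_eq exprS !mulrA => /eqP.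
have /dvdpP[Q1 QE] : p %| Q.
  by rewrite -(@Gauss_dvdpl _ _ w) -?E ?dvdp_mulIl // irreducible_poly_coprime.
exists Q1; apply: (mulIf wF0); rewrite mulrA divfK // -!tofracM.
congr (_%:F); apply: (mulfI (irredp_neq0 p_irr)); rewrite E QE.
by rewrite -!mulrA mulrCA.
Qed.

(** The same cancellation at the conjugate prime, transported by [tau]. *)
Lemma polynomial_strip_map (p r : {poly K}) n x : irreducible_poly p ->
  p_integral p (tau x) ->
  polynomial ((p^- ^+ n * r)%:F * x) -> polynomial (r%:F * x).
Proof.
move=> p_irr pI E; apply: polynomial_map; rewrite rmorphM /= ratfun_map_tofrac.
apply: (polynomial_strip p_irr pI (n := n)).
apply: polynomial_map; rewrite rmorphM /= ratfun_mapK // ratfun_map_tofrac.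
by rewrite rmorphM rmorphXn /= !map_polyK.
Qed.

Lemma polynomial_ratio_exp (a b : {poly K}) (k : int) : a != 0 -> b != 0 ->
  polynomial ((a ^+ `|k| * b ^+ `|k|)%:F * (a%:F / b%:F) ^ k).
Proof.
move=> aN0 bN0; have aF : a%:F != 0 :> L by rewrite tofrac_eq0.
have bF : b%:F != 0 :> L by rewrite tofrac_eq0.
rewrite tofracM !tofracXn; case: (k) => n.
  by exists (a ^+ n * a ^+ n); rewrite tofracM !tofracXn; apply: ratio_exp_pos.
rewrite -[`|Negz n|%N]/(n.+1).
by exists (b ^+ n.+1 * b ^+ n.+1); rewrite tofracM !tofracXn (ratio_exp_neg n aF bF).
Qed.

Lemma common_denominator m (B : 'M[L]_m) :
  exists2 q : {poly K}, q != 0 & forall i j, polynomial (q%:F * B i j).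
Proof.
have /fin_all_exists[nd ndP] (ij : 'I_m * 'I_m) : exists nd : {poly K} * {poly K},
    nd.2 != 0 /\ B ij.1 ij.2 = nd.1%:F / nd.2%:F.
  by have [n [d nd]] := frac_quot (B ij.1 ij.2); exists (n, d).
exists (\prod_ij (nd ij).2); first by apply/prodf_neq0 => ij _; case: (ndP ij).
move=> i j; have [dN0 ->] := ndP (i, j); rewrite (bigD1 (i, j)) //=.
exists ((nd (i, j)).1 * \prod_(ij | ij != (i, j)) (nd ij).2).
by rewrite !tofracM mulrC mulrA divfK ?tofrac_eq0.
Qed.

Let XF : L := 'X%:F.

Let tauX : tau XF = XF. Proof. by rewrite /XF ratfun_map_tofrac map_polyX. Qed.

(** Off the diagonal, the product is read off the principal minor on [[set i; j]]; the simple pole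
    of that minor is absorbed by one of the two factors [XF]. *)
Lemma polynomial_mul_conj m (B : 'M[L]_m) i j :
  (forall U, polynomial (XF * pminor B U)) ->
  polynomial (XF * B i j * (XF * B j i)).
Proof.
move=> XB; have XB1 k : polynomial (XF * B k k) by rewrite -pminor1.
have [<-|ne] := eqVneq i j; first exact: polynomialM.
have [P PE] := polynomialM (XB1 i) (XB1 j).
have [Q QE] := polynomialM (ex_intro _ 'X (erefl XF)) (XB [set i; j]).
exists (P - Q); rewrite tofracB -PE -QE pminor2 //; move: (XF) (B i i) (B j j) (B i j) (B j i).
by move=> *; ring.
Qed.

(** With [Q] the polynomial [q p XF B i j], the product [Q Q^-] is divisible by [p] because the norm
    of [XF B i j] is a polynomial. So [p] divides [Q] or [Q^-], and being associated to its
    conjugate it divides [Q]. *)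
Lemma self_conj_denominator m (B : 'M[L]_m) (p q : {poly K}) : irreducible_poly p ->
  p %| p^- -> (forall i j, B j i = tau (B i j)) ->
  (forall U, polynomial (XF * pminor B U)) ->
  (forall i j, polynomial ((q * p)%:F * (XF * B i j))) ->
  forall i j, polynomial (q%:F * (XF * B i j)).
Proof.
move=> p_irr pp hB XB qB i j; have [Q QE] := qB i j.
have pF0 : p%:F != 0 :> L by rewrite tofrac_eq0 irredp_neq0.
suff /dvdpP[Q1 Q1E] : p %| Q.
  exists Q1; apply: (mulIf pF0); rewrite -tofracM -Q1E -QE tofracM.
  by rewrite mulrAC.
have [R RE] := polynomial_mul_conj i j XB.
have QQ : Q * Q^- = (q * p) * ((q * p)^- * R).
  apply/eqP; rewrite -tofrac_eq (tofracM Q) (tofracM (q * p)) (tofracM (q * p)^-) -RE.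
  rewrite -!(ratfun_map_tofrac sigma) -QE (rmorphM tau) (rmorphM tau XF) /= tauX -hB.
  by apply/eqP; move: (_%:F) (tau _) XF (B i j) (B j i) => *; ring.
have : p %| Q * Q^- by rewrite QQ -mulrA dvdp_mull // dvdp_mulr.
have [//|pQ] := boolP (p %| Q).
rewrite Gauss_dvdpr ?irreducible_poly_coprime // -(dvdp_map sigma) map_polyK // => pQ'.
by case/negP: pQ; apply: dvdp_trans pQ'.
Qed.

(* Conjugating by powers of the unitary function [p / p^-] removes the primes   *)
(* [p] and [p^-] from the denominators at once.                                 *)
Lemma p_adic_scaling m (B : 'M[L]_m) (p q : {poly K}) : irreducible_poly p ->
  ~~ (p %| p^-) -> (forall i j, B j i = tau (B i j)) ->
  (forall U, polynomial (XF * pminor B U)) ->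
  (forall i j, polynomial ((q * p)%:F * (XF * B i j))) ->
  exists d : 'I_m -> L, (forall i, d i * tau (d i) = 1) /\
    forall i j, polynomial (q%:F * (XF * (d i * B i j * tau (d j)))).
Proof.
move=> p_irr npp hB XB qB; have pN0 := irredp_neq0 p_irr.
(* The pole at [y = 0] is not touched: ['X] is its own conjugate, while [p] is not associated to
   [p^-]. *)
have pX : ~~ (p %| 'X).
  apply: contra npp => pX; have p1 : size p != 1%N by case: p_irr => + _; case: ltngtP.
  have X_irr : irreducible_poly ('X : {poly K}) by have := irredp_XsubC (0 : K); rewrite subr0.
  have pE := apply_irredp X_irr p1 pX.
  have : p^- %= 'X by rewrite -(map_polyX sigma) eqp_map.
  by rewrite (eqp_dvdl _ pE) => /eqp_dvdr ->.
have XF0 : XF != 0 by rewrite tofrac_eq0 polyX_eq0.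
have pB U : p_integral p (pminor B U).
  have [Q QE] := XB U; rewrite -[pminor B U](mulKf XF0) QE mulrC.
  by apply: p_integralM; [exact: p_irr|exact: p_integral_tofrac|exact: p_integralV].
have [e eP] := p_integral_potential p_irr pB.
have pmN0 : p^- != 0 by rewrite map_poly_eq0.
pose r : L := p%:F / p^- %:F.
have pF0 : p%:F != 0 :> L by rewrite tofrac_eq0.
have pmF0 : p^- %:F != 0 :> L by rewrite tofrac_eq0.
have rN0 : r != 0 := mulf_neq0 pF0 (invr_neq0 pmF0).
have tau_r : tau r = r^-1 by rewrite /r ratfun_map_div // map_polyK // invf_div.
have tau_rX k : tau (r ^ k) = r ^ (- k) by rewrite fmorphXz /= tau_r exprz_inv.
pose d i := r ^ e i; have dE i j : d i * B i j * tau (d j) = r ^ (e i - e j) * B i j.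
  by rewrite /d tau_rX mulrAC -(expfzDr _ _ rN0).
exists d; split=> [i|i j]; first by rewrite /d tau_rX -(expfzDr _ _ rN0) subrr expr0z.
have pI k l : p_integral p (XF * (r ^ (e k - e l) * B k l)).
  apply: p_integralM => //; first exact: p_integral_tofrac.
  rewrite /r expfzMl mulrAC exprz_inv; apply: p_integralM => //; exact: p_integralXz.
rewrite dE; set x := XF * _.
have tau_x : tau x = XF * (r ^ (e j - e i) * B j i).
  by rewrite /x !(rmorphM tau) /= tauX tau_rX opprB -hB.
(* [N] powers of [p] and of [p^-] clear the power of [r]; the further factor [p] is the one in
   [q * p]. *)
set N := `|(e i - e j)%R|%N.
apply: (@polynomial_strip_map p q N x p_irr); first by rewrite tau_x.
apply: (@polynomial_strip p _ N.+1 x p_irr); first exact: pI.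
have -> : (p ^+ N.+1 * (p^- ^+ N * q))%:F * x =
    ((p ^+ N * p^- ^+ N)%:F * r ^ (e i - e j)) * ((q * p)%:F * (XF * B i j)).
  rewrite /x exprS !tofracM; move: (_ ^ _) => y.
  by move: (p%:F) (_%:F) (_%:F) (q%:F) XF (B i j) => *; ring.
by apply: polynomialM => //; apply: polynomial_ratio_exp.
Qed.

(** Induction on the size of a common denominator [q], losing an irreducible factor each time.
    Unitary scalings compose and preserve both hypotheses. *)
Lemma polynomial_scaling m (B : 'M[L]_m) :
  (forall i j, B j i = tau (B i j)) -> (forall U, polynomial (XF * pminor B U)) ->
  exists d : 'I_m -> L, (forall i, d i * tau (d i) = 1) /\
    forall i j, polynomial (XF * (d i * B i j * tau (d j))).
Proof.
have [q qN0 qB] := common_denominator (\matrix_(i, j) (XF * B i j)).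
have {}qB i j : polynomial (q%:F * (XF * B i j)) by have := qB i j; rewrite mxE.
have [n] := ubnP (size q); elim: n q B qN0 qB => // n IHn q B qN0 qB leq hB XB.
have [q1|q1] := leqP (size q) 1.
  exists (fun=> 1); split=> [i|i j]; first by rewrite rmorph1 mulr1.
  move: qN0 qB; rewrite (size1_polyC q1) polyC_eq0; move: (q`_0) => c cN0 /(_ i j)[Q QE].
  exists (c^-1%:P * Q); rewrite rmorph1 mul1r mulr1 tofracM -QE mulrA -tofracM -polyCM.
  by rewrite mulVf // tofrac1 mul1r.
have [p p_irr /dvdpP[q' qE]] := irreducible_factor q1.
have q'N0 : q' != 0 by apply: contraNneq qN0 => q'0; rewrite qE q'0 mul0r.
have lt : (size q' < n)%N.
  move: leq; rewrite qE size_mul ?(irredp_neq0 p_irr) // ltnS; apply: leq_trans.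
  case: p_irr => p1 _.
  by rewrite -subn1 -addnBA ?(ltnW p1) // -addn1 leq_add2l subn_gt0.
rewrite {}qE in qB; have [pp|npp] := boolP (p %| p^-).
  by apply: (IHn q') => //; apply: self_conj_denominator qB.
have [d [dd q'B]] := p_adic_scaling p_irr npp hB XB qB.
have dN0 i : d i != 0.
  by apply: contra_eqN (dd i) => /eqP ->; rewrite mul0r eq_sym oner_eq0.
have tau_d i : tau (d i) = (d i)^-1 by rewrite -[LHS](mulKf (dN0 i)) dd mulr1.
pose B' : 'M[L]_m := \matrix_(i, j) (d i * B i j / d j).
have [|i j|U|d' [dd' B'P]] := IHn q' B' q'N0 _ lt.
- by move=> i j; rewrite mxE -tau_d.
- rewrite !mxE -(tau_d i) -(tau_d j) (rmorphM tau) (rmorphM tau (d i)) /= ratfun_mapK // -hB.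
  by rewrite mulrC -[in RHS]mulrA [B j i * _]mulrC.
- by rewrite pminor_scale.
exists (fun i => d i * d' i); split=> [i|i j].
  by rewrite (rmorphM tau) mulrACA dd dd' mulr1.
have := B'P i j; rewrite mxE -tau_d (rmorphM tau) /=; congr (polynomial (_ * _)).
by move: (tau (d j)) (tau (d' j)) (d i) (d' i) (B i j) => *; ring.
Qed.
End PolynomialScaling.

(** * Hermitian matrices with prescribed principal minors *)

(** [pt false] is the point 0 and [pt true] the point at infinity of the projective line. *)
Definition pt (R : pzRingType) (b c : bool) : R := (c == b)%:R.
Arguments pt {R} b c.

Definition upd (T : eqType) (S : Type) (w : T -> S) (i : T) (u : S) : T -> S :=
  fun k => if k == i then u else w k.

Lemma eq_maform (R : pzRingType) m (a a' : {set 'I_m} -> R) w w' :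
  a =1 a' -> w =2 w' -> maform a w = maform a' w'.
Proof.
move=> eqa eqw; apply: eq_bigr => U _; rewrite eqa; congr (_ * _).
by apply: eq_bigr => i _; rewrite eqw.
Qed.

Lemma eq_maformr (R : pzRingType) m (a : {set 'I_m} -> R) w w' :
  w =2 w' -> maform a w = maform a w'.
Proof. exact: eq_maform. Qed.

Lemma map_maform (R S : comPzRingType) (f : {rmorphism R -> S}) m
    (a : {set 'I_m} -> R) (w : 'I_m -> bool -> R) :
  f (maform a w) = maform (fun U => f (a U)) (fun i b => f (w i b)).
Proof.
by rewrite rmorph_sum; apply: eq_bigr => U _; rewrite rmorphM rmorph_prod.
Qed.

Lemma maform_linear (R : comPzRingType) m (c c' : R) (a a' : {set 'I_m} -> R) w :
  maform (fun U => c * a U + c' * a' U) w = c * maform a w + c' * maform a' w.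
Proof.
rewrite /maform !mulr_sumr -big_split; apply: eq_bigr => U _ /=.
by rewrite mulrDl !mulrA.
Qed.

Lemma prod_upd (R : comPzRingType) m (w : 'I_m -> bool -> R) n u (U : {set 'I_m}) :
  \prod_i upd w n u i (i \in U) = u (n \in U) * \prod_(i | i != n) w i (i \in U).
Proof.
rewrite (bigD1 n) //= /upd eqxx; congr (_ * _).
by apply: eq_bigr => i /negPf ->.
Qed.

Lemma maform_upd (R : comPzRingType) m (a : {set 'I_m} -> R) w n u :
  maform a (upd w n u) =
  u false * maform a (upd w n (pt false)) + u true * maform a (upd w n (pt true)).
Proof.
rewrite /maform !mulr_sumr -big_split; apply: eq_bigr => U _ /=.
rewrite !prod_upd.
by case: (n \in U); rewrite /pt /=; ring.
Qed.

Lemma maform_shift (R : comPzRingType) m (a : {set 'I_m} -> R) w n :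
  maform a (upd w n (pt true)) = maform (fun U => a (n |: U)) (upd w n (pt false)).
Proof.
pose h (U : {set 'I_m}) := if n \in U then U :\ n else n |: U.
have hK : involutive h.
  move=> U; rewrite /h; have [nU|nU] := boolP (n \in U); first by rewrite setD11 setD1K.
  by rewrite setU11 setU1K.
rewrite /maform (reindex_inj (can_inj hK)); apply: eq_bigr => U _.
rewrite !prod_upd /h.
case: ifP => nU; first by rewrite setD11 /pt /= !(mul0r, mulr0).
rewrite setU11 /pt /= !mul1r; congr (_ * _); apply: eq_bigr => i ne.
by rewrite in_setU1 (negPf ne).
Qed.

Lemma maform_pt (R : comPzRingType) m (a : {set 'I_m} -> R) (S : {set 'I_m}) :
  maform a (fun k => pt (k \in S)) = a S.
Proof.
rewrite /maform (bigD1 S) //= [X in _ + X]big1 ?addr0 => [|U neU].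
  by rewrite big1 ?mulr1 // => i _; rewrite /pt eqxx.
have [i neq] : exists i, (i \in U) != (i \in S).
  apply/existsP; apply: contraNT neU; rewrite negb_exists => /forallP eqU.
  by apply/eqP/setP => i; apply/eqP; rewrite -[_ == _]negbK.
by rewrite (bigD1 i) //= /pt (negPf neq) mul0r mulr0.
Qed.

(** If [f = F00 + F10 x_i + F01 x_j + F11 x_i x_j], then the Rayleigh difference is
    [F10 F01 - F00 F11], whatever the coordinates of [w] at [i] and [j]. *)
Definition rayleigh (R : pzRingType) m (a : {set 'I_m} -> R) (i j : 'I_m)
    (w : 'I_m -> bool -> R) : R :=
  let F b c := maform a (upd (upd w i (pt b)) j (pt c)) in
  F true false * F false true - F false false * F true true.

(* Quantifying over all extensions of [K] makes the condition pass to [K(y)].   *)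
Definition rayleigh_norms (K : fieldType) (sigma : {rmorphism K -> K}) m
    (N : {set 'I_m}) (a : {set 'I_m} -> K) : Prop :=
  forall (K' : fieldType) (sigma' : {rmorphism K' -> K'}) (iota : {rmorphism K -> K'}),
  (forall c, sigma' (iota c) = iota (sigma c)) ->
  forall w : 'I_m -> bool -> K', (forall k b, sigma' (w k b) = w k b) ->
  (forall k, k \notin N -> w k =1 pt false) ->
  forall i j, i \in N -> j \in N -> i != j ->
  exists z, rayleigh (fun U => iota (a U)) i j w = z * sigma' z.

(** If the diagonal vanishes, the minors of order two force [C = 0]. Otherwise the Schur complement
    of a nonzero [C k k] has zero principal minors of orders one and two, so it vanishes, and [v] is
    column [k] up to a factor. *)
Lemma rank_one_hermitian (K : fieldType) (sigma : {rmorphism K -> K}) m (C : 'M[K]_m) :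
  involutive sigma ->
  (forall i j, C j i = sigma (C i j)) ->
  (forall U : {set 'I_m}, (1 < #|U|)%N -> pminor C U = 0) ->
  (forall i, exists z, C i i = - (z * sigma z)) ->
  exists v : 'I_m -> K, forall i j, C i j = - (v i * sigma (v j)).
Proof.
move=> sigmaK hC C0 Cnorm.
have herm0 (M : 'M[K]_m) i j : M j i = sigma (M i j) -> M i j * M j i = 0 -> M i j = 0.
  by move=> -> /eqP; rewrite mulf_eq0 fmorph_eq0 orbb => /eqP.
have [/forallP Cd | /forallPn[k Ck]] := boolP [forall i, C i i == 0].
  exists (fun=> 0) => i j; rewrite mul0r oppr0.
  have [<-|ne] := eqVneq i j; first exact/eqP/Cd.
  apply: herm0 => //; have := C0 [set i; j]; rewrite cards2 ne pminor2 // => /(_ isT).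
  by rewrite (eqP (Cd i)) mul0r sub0r => /eqP; rewrite oppr_eq0 => /eqP.
have [z zE] := Cnorm k.
have zN0 : z != 0 by apply: contraNneq Ck => z0; rewrite zE z0 mul0r oppr0.
have szN0 : sigma z != 0 by rewrite fmorph_eq0.
pose S := \matrix_(i, j) (C i j - C i k * C k j / C k k).
have SU (U : {set 'I_m}) : k \notin U -> (0 < #|U|)%N -> pminor S U = 0.
  move=> kU U0; apply: (mulfI Ck); rewrite mulr0 -pminor_schur // C0 //.
  by rewrite cardsU1 kU.
have hS i j : S j i = sigma (S i j).
  by rewrite !mxE rmorphB rmorphM rmorphM /= fmorphV -!hC [C j k * _]mulrC.
have Sk i : S i k = 0 by rewrite mxE mulfK // subrr.
have S0 i j : S i j = 0.
  have [->|nei] := eqVneq i k; first by rewrite hS Sk rmorph0.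
  have [->|nej] := eqVneq j k; first exact: Sk.
  have Sd l : l != k -> S l l = 0 by move=> ne; rewrite -pminor1 SU ?cards1 // inE eq_sym.
  have [<-|ne] := eqVneq i j; first exact: Sd.
  apply: herm0 => //; have := SU [set i; j]; rewrite !inE negb_or ![k == _]eq_sym nei nej.
  rewrite cards2 pminor2 // Sd // mul0r sub0r => /(_ isT isT) /eqP.
  by rewrite oppr_eq0 => /eqP.
exists (fun i => - C i k / sigma z) => i j.
have := S0 i j; rewrite mxE => /eqP; rewrite subr_eq0 => /eqP ->.
rewrite rmorphM rmorphN fmorphV sigmaK -hC zE; field.
by rewrite zN0 szN0 oppr_eq0 mulf_neq0.
Qed.

Lemma expr_split_mul (R : comPzRingType) (x y : R) k :
  x ^+ k.+2 * y = x * (x ^+ k * (x * y)).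
Proof. by rewrite !exprS -!mulrA; congr (_ * _); rewrite mulrCA. Qed.

Lemma size_mul_le3 (R : nzRingType) (p q : {poly R}) :
  (size p <= 2)%N -> (size q <= 2)%N -> (size (p * q)%R <= 3)%N.
Proof.
by move=> p2 q2; apply: leq_trans (size_polyMleq _ _) _; rewrite -subn1 leq_subLR (leq_add p2 q2).
Qed.

Lemma size_poly_le2_of_mul (F : fieldType) (p q : {poly F}) :
  size q = size p -> (size (p * q)%R <= 3)%N -> (size p <= 2)%N.
Proof.
have [->|p0] := eqVneq p 0; first by rewrite size_poly0.
move=> qp; have q0 : q != 0 by rewrite -size_poly_eq0 qp size_poly_eq0.
by rewrite size_mul // qp; move: (size p) => s; lia.
Qed.

(** * The inductive step: Schur complement over [K(y)] and bordering *)

Section BorderStep.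
Variables (K : fieldType) (sigma : {rmorphism K -> K}) (m : nat).
Hypothesis sigmaK : involutive sigma.
Local Notation L := {fraction {poly K}}.
Local Notation tau := (ratfun_map sigma).
Local Notation X := ('X%:F : L).
Variables (a : {set 'I_m} -> K) (N : {set 'I_m}) (n : 'I_m).
Hypotheses (nN : n \notin N) (a0 : a set0 = 1) (aR : forall U, sigma (a U) = a U).

(** The constant term in [y] of [a U * x_n + a (n |: U)] at [x_n = y - a [set n]]. *)
Definition schur_coef (U : {set 'I_m}) : K := a (n |: U) - a [set n] * a U.

Definition schur_poly (U : {set 'I_m}) : {poly K} := a U *: 'X + (schur_coef U)%:P.

Definition ratfun_cst : {rmorphism K -> L} := (@FracField.tofrac {poly K} \o polyC).

(* The principal minors of the Schur complement of the entry [y] at [n], where  *)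
(* [y] stands for [x_n + a [set n]].                                            *)
Definition schur_minor (U : {set 'I_m}) : L := (schur_poly U)%:F / X.

Lemma XF_neq0 : X != 0. Proof. by rewrite tofrac_eq0 polyX_eq0. Qed.

Lemma schur_minorE U :
  schur_minor U = ratfun_cst (a U) + ratfun_cst (schur_coef U) / X.
Proof.
rewrite /schur_minor /schur_poly -mul_polyC tofracD tofracM mulrDl mulfK //.
exact: XF_neq0.
Qed.

Lemma schur_coefR U : sigma (schur_coef U) = schur_coef U.
Proof. by rewrite rmorphB rmorphM !aR. Qed.

Lemma schur_minor0 : schur_minor set0 = 1.
Proof.
by rewrite schur_minorE /schur_coef setU0 a0 mulr1 subrr !rmorph0 mul0r addr0 rmorph1.
Qed.

Lemma schur_minorR U : tau (schur_minor U) = schur_minor U.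
Proof.
rewrite /schur_minor ratfun_map_div ?polyX_eq0 // map_polyX; congr (_%:F / _).
rewrite /schur_poly -mul_polyC rmorphD rmorphM /= !map_polyC map_polyX /=.
by rewrite aR schur_coefR.
Qed.

Lemma ratfun_cst_map c : tau (ratfun_cst c) = ratfun_cst (sigma c).
Proof. by rewrite /= ratfun_map_tofrac map_polyC. Qed.

(** A value of the form of [schur_minor] is [1 / y] times a value of the form of [a] at [x_n = y - a
    [set n]]. The Rayleigh difference is thus divided by [y ^+ 2], the norm of the fixed element
    [y]. *)
Lemma schur_rayleigh_norms :
  rayleigh_norms sigma (n |: N) a -> rayleigh_norms tau N schur_minor.
Proof.
move=> norms K' sigma' iota iotaE w wR wN i j Ni Nj neij.
have nei : i != n by apply: contraNneq nN => <-.
have nej : j != n by apply: contraNneq nN => <-.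
pose io : {rmorphism K -> K'} := (iota \o ratfun_cst).
pose y := iota X; have yN0 : y != 0 by rewrite fmorph_eq0 XF_neq0.
pose b U := io (a U); pose P := fun c : bool => if c then 1 else y - b [set n].
have yR : sigma' y = y by rewrite /y iotaE /= ratfun_map_tofrac map_polyX.
have ioE c : sigma' (io c) = io (sigma c) by rewrite -[RHS]/(iota (ratfun_cst (sigma c)))
  -ratfun_cst_map -iotaE.
have sE U : iota (schur_minor U) = io (a U) + io (schur_coef U) / y.
  by rewrite schur_minorE rmorphD rmorphM fmorphV.
have formE w1 : w1 n =1 pt false ->
    maform b (upd w1 n P) = y * maform (fun U => iota (schur_minor U)) w1.
  move=> w1n; have w1E : w1 =2 upd w1 n (pt false).
    by move=> k c; rewrite /upd; case: eqP => // ->.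
  rewrite maform_upd maform_shift -!(eq_maformr _ w1E) /P.
  rewrite -maform_linear.
  transitivity (maform (fun U => y * iota (schur_minor U) + 0 * b U) w1); last first.
    by rewrite maform_linear mul0r addr0.
  apply: eq_maform => // U; rewrite sE /schur_coef rmorphB rmorphM /b.
  move: (io (a U)) (io (a _)) (io (a _)) => *; field.
  exact: yN0.
have [|||||z zE] := norms K' sigma' io ioE (upd w n P) _ _ i j.
- move=> k c; rewrite /upd; case: eqP => _ //; rewrite /P.
  by case: c; rewrite ?rmorph1 // rmorphB yR /b ioE aR.
- move=> k; rewrite in_setU1 negb_or => /andP[nek kN] c.
  by rewrite /upd (negPf nek) wN.
- by rewrite in_setU1 Ni orbT.
- by rewrite in_setU1 Nj orbT.
- exact: neij.
exists (z / y); rewrite rmorphM fmorphV yR mulf_div -zE.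
rewrite /rayleigh -/b.
have updE c d : maform b (upd (upd (upd w n P) i (pt c)) j (pt d)) =
    y * maform (fun U => iota (schur_minor U)) (upd (upd w i (pt c)) j (pt d)).
  rewrite -formE; last by move=> e; rewrite /upd ![n == _]eq_sym (negPf nei) (negPf nej) wN.
  apply: eq_maformr => k e; rewrite /upd.
  by have [->|] := eqVneq k n; rewrite // ![n == _]eq_sym (negPf nei) (negPf nej).
rewrite !updE; move: (maform _ _) (maform _ _) (maform _ _) (maform _ _) => *.
by field; rewrite yN0.
Qed.

(** Replace the corner [a [set n]] by [y]. The minor on [n |: U] becomes [y] times a Schur
    complement minor, hence [schur_poly U]; comparing the coefficients of [y] yields both minors. *)
Lemma border_minors (A : 'M[K]_m) (v : 'I_m -> K) :
  (forall U : {set 'I_m}, U \subset N ->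
    pminor (\matrix_(i, j) (ratfun_cst (A i j) - ratfun_cst (v i * sigma (v j)) / X)) U =
    schur_minor U) ->
  forall U : {set 'I_m}, U \subset n |: N ->
    pminor (\matrix_(i, j) if i == n then (if j == n then a [set n] else sigma (v j))
      else if j == n then v i else A i j) U = a U.
Proof.
move=> AE; set M := \matrix_(i, j) _.
pose MX := map_mx ratfun_cst M + (X - ratfun_cst (a [set n])) *: delta_mx n n.
have MXn i j : j != n -> MX i j = ratfun_cst (M i j).
  by move=> nej; rewrite !mxE (negPf nej) andbF mulr0 addr0.
have MXn' i j : i != n -> MX i j = ratfun_cst (M i j).
  by move=> nei; rewrite !mxE (negPf nei) mulr0 addr0.
have MXnn : MX n n = X by rewrite !mxE !eqxx mulr1 addrC subrK.
suff both (U : {set 'I_m}) : U \subset N -> pminor M U = a U /\ pminor M (n |: U) = a (n |: U).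
  move=> U UN; have [nU|nU] := boolP (n \in U); last first.
    by case: (both U) => //; rewrite -(setU1K nN) subsetD1 UN.
  case: (both (U :\ n)); last by rewrite setD1K.
  by rewrite subDset.
move=> UN; have nU : n \notin U by apply: contra nN; apply: (subsetP UN).
have : pminor MX (n |: U) = (schur_poly U)%:F.
  rewrite pminor_schur ?MXnn ?XF_neq0 // -[RHS](divfK XF_neq0) -/(schur_minor U) -AE // mulrC.
  congr (_ * _); apply: eq_pminor => i j Ui Uj.
  have nei : i != n by apply: contraNneq nU => <-.
  have nej : j != n by apply: contraNneq nU => <-.
  rewrite [LHS]mxE [RHS]mxE (MXn i j) // (MXn' i n) // (MXn n j) // !mxE eqxx.
  by rewrite (negPf nei) (negPf nej) [in RHS]rmorphM.
rewrite pminorD_diag // !map_pminor /= -tofracB -tofracM -tofracD => /eqP; rewrite tofrac_eq.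
move=> /eqP/polyP E; have := E 0%N; have := E 1%N.
rewrite /schur_poly !(coefD, coefN, coefMC, coefX, coefC, coefZ) /=.
rewrite !(oppr0, add0r, addr0, mulr0, mulr1, mul1r) => E1.
move=> /eqP; rewrite mulNr subr_eq /schur_coef E1 subrK => /eqP ->.
by split.
Qed.

Lemma schur_complement_split (B : 'M[L]_m) :
  (forall i j, B j i = tau (B i j)) ->
  (forall U : {set 'I_m}, U \subset N -> pminor B U = schur_minor U) ->
  (forall i, i \in N -> exists z, schur_coef [set i] = - (z * sigma z)) ->
  exists (A : 'M[K]_m) (v : 'I_m -> K), (forall i j, A j i = sigma (A i j)) /\
  forall U : {set 'I_m}, U \subset N ->
    pminor (\matrix_(i, j) (ratfun_cst (A i j) - ratfun_cst (v i * sigma (v j)) / X)) U =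
    schur_minor U.
Proof.
move=> hB pB normN.
(* Entries outside [N] are set to zero so that all principal minors are controlled. *)
pose B0 : 'M[L]_m := \matrix_(i, j) if (i \in N) && (j \in N) then B i j else 0.
have hB0 i j : B0 j i = tau (B0 i j).
  by rewrite !mxE andbC; case: ifP => _; [exact: hB|rewrite rmorph0].
have pB0 (U : {set 'I_m}) : pminor B0 U = if U \subset N then schur_minor U else 0.
  case: ifPn => [UN|/subsetPn[i Ui nNi]].
    rewrite -pB //; apply: eq_pminor => i j Ui Uj.
    by rewrite mxE !(subsetP UN).
  by apply: (pminor_row0 Ui) => j; rewrite mxE (negPf nNi).
have XB0 U : polynomial (X * pminor B0 U).
  rewrite pB0; case: ifP => _; last by exists 0; rewrite mulr0 tofrac0.
  by exists (schur_poly U); rewrite mulrC divfK // XF_neq0.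
have [d [dd dP]] := polynomial_scaling sigmaK hB0 XB0.
have dN0 i : d i != 0.
  by apply: contra_eqN (dd i) => /eqP ->; rewrite mul0r eq_sym oner_eq0.
have tau_d i : tau (d i) = (d i)^-1 by rewrite -[LHS](mulKf (dN0 i)) dd mulr1.
pose B1 : 'M[L]_m := \matrix_(i, j) (d i * B0 i j / d j).
have pB1 U : pminor B1 U = pminor B0 U by rewrite pminor_scale.
have /fin_all_exists[P PE] (ij : 'I_m * 'I_m) : exists Q : {poly K}, X * B1 ij.1 ij.2 = Q%:F.
  by have [Q QE] := dP ij.1 ij.2; exists Q; rewrite -QE mxE tau_d.
have {}PE i j : X * B1 i j = (P (i, j))%:F := PE (i, j).
have B1E i j : B1 i j = (P (i, j))%:F / X by rewrite -PE mulrAC divff ?mul1r // XF_neq0.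
have hB1 i j : B1 j i = tau (B1 i j).
  rewrite [LHS]mxE [B1 i j]mxE -(tau_d i) -(tau_d j) (rmorphM tau) (rmorphM tau (d i)) /=
    ratfun_mapK //.
  by rewrite -hB0 mulrC -[in RHS]mulrA [B0 j i * _]mulrC.
have hP i j : P (j, i) = map_poly sigma (P (i, j)).
  apply/eqP; rewrite -tofrac_eq -PE hB1 -(ratfun_map_tofrac sigma) -PE (rmorphM tau) /=.
  by rewrite ratfun_map_tofrac map_polyX.
have schurF (U : {set 'I_m}) : U \subset N -> X * pminor B1 U = (schur_poly U)%:F.
  by move=> UN; rewrite pB1 pB0 UN mulrC divfK // XF_neq0.
have schur0 (U : {set 'I_m}) : ~~ (U \subset N) -> pminor B1 U = 0.
  by move=> /negPf UN; rewrite pB1 pB0 UN.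
have PU (U : {set 'I_m}) : exists2 Q : {poly K}, (size Q <= 2)%N & X * pminor B1 U = Q%:F.
  have [/schurF ->|/schur0 ->] := boolP (U \subset N); last first.
    by exists 0; rewrite ?size_poly0 // mulr0 tofrac0.
  exists (schur_poly U) => //; rewrite /schur_poly -mul_polyC.
  by rewrite (leq_trans (size_polyD _ _)) // geq_max size_polyC -[X in (_ <= X)%N]/(1 + 1)%N;
    rewrite (leq_trans (size_polyMleq _ _)) ?size_polyC ?size_polyX //; case: eqP.
(* Off the diagonal, [P (i, j) * P (j, i)] has degree at most two by the minor of order two, and the
   conjugate factors have equal degree. *)
have Psize i j : (size (P (i, j)) <= 2)%N.
  have Pd k : (size (P (k, k)) <= 2)%N.
    by have [Q szQ] := PU [set k]; rewrite pminor1 PE => /eqP; rewrite tofrac_eq => /eqP ->.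
  have [<-|ne] := eqVneq i j; first exact: Pd.
  have [Q szQ QE] := PU [set i; j].
  have PP : P (i, j) * P (j, i) = P (i, i) * P (j, j) - 'X * Q.
    apply/eqP; rewrite -tofrac_eq tofracB !tofracM -!PE -QE pminor2 //.
    by apply/eqP; move: (X) (B1 i i) (B1 j j) (B1 i j) (B1 j i) => *; ring.
  apply: (@size_poly_le2_of_mul _ _ (P (j, i))); first by rewrite hP size_map_poly.
  rewrite PP (leq_trans (size_polyD _ _)) // geq_max size_polyN.
  by rewrite !size_mul_le3 ?size_polyX.
pose A : 'M[K]_m := \matrix_(i, j) (P (i, j))`_1.
pose C : 'M[K]_m := \matrix_(i, j) (P (i, j))`_0.
have PAC i j : P (i, j) = (A i j)%:P * 'X + (C i j)%:P.
  apply/polyP => k; rewrite coefD coefCM coefX coefC !mxE.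
  case: k => [|[|k]] /=; rewrite ?mulr0 ?mulr1 ?add0r ?addr0 //.
  by rewrite nth_default // (leq_trans (Psize i j)).
have hA i j : A j i = sigma (A i j) by rewrite !mxE hP coef_map.
have hC i j : C j i = sigma (C i j) by rewrite !mxE hP coef_map.
(* For [#|U| = k.+2], the minor of [X B1] is [X ^+ k.+2] times one with at most a simple pole, so it
   vanishes at 0. *)
have C0 (U : {set 'I_m}) : (1 < #|U|)%N -> pminor C U = 0.
  pose PM : 'M[{poly K}]_m := \matrix_(i, j) P (i, j).
  have -> : C = map_mx (horner_eval 0) PM.
    by apply/matrixP => i j; rewrite !mxE /horner_eval horner_coef0.
  rewrite map_pminor => U1.
  have [Q _ QE] := PU U; have [k kE] : exists k, #|U| = k.+2 by exists (#|U| - 2)%N; lia.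
  have -> : pminor PM U = 'X * ('X^k * Q).
    apply/eqP; rewrite -tofrac_eq !tofracM -QE tofracXn -(map_pminor (@FracField.tofrac _)).
    have -> : map_mx (@FracField.tofrac _) PM = X *: B1.
      by apply/matrixP => i j; rewrite [RHS]mxE PE !mxE.
    by rewrite pminorZ kE expr_split_mul.
  by rewrite /= /horner_eval hornerM hornerX mul0r.
have Cd i : exists z, C i i = - (z * sigma z).
  have [iN|niN] := boolP (i \in N); last first.
    exists 0; rewrite mul0r oppr0 mxE.
    have /eqP := PE i i; rewrite -(pminor1 B1) schur0 ?sub1set // mulr0 eq_sym tofrac_eq0.
    by move=> /eqP ->; rewrite coef0.
  have [z zE] := normN i iN; exists z; rewrite -zE mxE.
  have /eqP := PE i i; rewrite -(pminor1 B1) schurF ?sub1set // tofrac_eq => /eqP <-.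
  by rewrite /schur_poly coefD coefZ coefX mulr0 add0r coefC.
have [v vE] := rank_one_hermitian sigmaK hC C0 Cd.
exists A, v; split=> // U UN; have := pB0 U; rewrite UN -pB1 => <-.
apply: eq_pminor => i j _ _; rewrite mxE B1E PAC tofracD tofracM mulrDl mulfK ?XF_neq0 //.
by rewrite vE polyCN tofracN mulNr.
Qed.
End BorderStep.

(** Induction on [#|N|] for all fields at once, since the induction hypothesis is used over
    [K(y)]. *)
Lemma hermitian_of_principal_minors (K : fieldType) (sigma : {rmorphism K -> K}) m
    (N : {set 'I_m}) (a : {set 'I_m} -> K) :
  involutive sigma -> a set0 = 1 -> (forall U, sigma (a U) = a U) ->
  rayleigh_norms sigma N a ->
  exists A : 'M[K]_m, (forall i j, A j i = sigma (A i j)) /\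
    forall U : {set 'I_m}, U \subset N -> pminor A U = a U.
Proof.
have [k] := ubnP #|N|; elim: k K sigma N a => // k IHk K sigma N a leN sigmaK a0 aR norms.
have [N0|[n nN]] := set_0Vmem N.
  exists 0; split=> [i j|U]; first by rewrite !mxE rmorph0.
  by rewrite N0 subset0 => /eqP ->; rewrite pminor0.
have nN' : n \notin N :\ n by rewrite setD11.
(* At the origin, the Rayleigh difference for [i] and [n] is [a [set i] * a [set n] - a [set i; n]],
   the opposite of [schur_coef]. *)
have normN i : i \in N :\ n -> exists z, schur_coef a n [set i] = - (z * sigma z).
  rewrite !inE => /andP[nei Ni].
  have [|||z zE] // := norms K sigma idfun _ (fun _ => pt false) _ _ i n Ni nN nei.
    by move=> l b; rewrite /pt rmorph_nat.
  exists z; rewrite -zE /rayleigh /schur_coef.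
  have ptE b c : maform (fun U => idfun (a U)) (upd (upd (fun=> pt false) i (pt b)) n (pt c)) =
      a ((if b then [set i] else set0) :|: (if c then [set n] else set0)).
    rewrite -[RHS]maform_pt; apply: eq_maformr => l x; rewrite /upd.
    have [->|nel] := eqVneq l n.
      by congr (pt _ x); case: b; case: c; rewrite !inE ?eqxx ?orbT // eq_sym (negPf nei).
    have [->|nel'] := eqVneq l i.
      by congr (pt _ x); case: b; case: c; rewrite !inE ?eqxx ?(negPf nei).
    by congr (pt _ x); case: b; case: c; rewrite !inE ?(negPf nel) ?(negPf nel').
  by rewrite !ptE !setU0 !set0U a0 setUC; ring.
have leN' : (#|N :\ n| < k)%N by move: leN; rewrite (cardsD1 n) nN.
have normL : rayleigh_norms (ratfun_map sigma) (N :\ n) (schur_minor a n).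
  by apply: schur_rayleigh_norms => //; rewrite setD1K.
have [B [hB pB]] := IHk _ _ _ _ leN' (ratfun_mapK sigmaK) (schur_minor0 n a0)
  (schur_minorR n aR) normL.
have [A [v [hA pA]]] := schur_complement_split sigmaK nN' hB pB normN.
have := border_minors nN' pA; rewrite setD1K // => pM.
eexists; split; last exact: pM.
by move=> i j; rewrite !mxE; case: eqP => _; case: eqP => _; rewrite ?aR ?sigmaK // hA.
Qed.

(** * Multiaffine polynomials and determinantal representations *)

Lemma updC (T : eqType) (A B : Type) (w : T -> A -> B) i j u v : i != j ->
  upd (upd w i u) j v =2 upd (upd w j v) i u.
Proof.
move=> neij k c; rewrite /upd; have [->|//] := eqVneq k j.
by rewrite eq_sym (negPf neij).
Qed.

Lemma upd_id (T : eqType) (A B : Type) (w : T -> A -> B) i : w =2 upd w i (w i).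
Proof. by move=> k c; rewrite /upd; case: eqP => // ->. Qed.

Section MpolyForm.
Variables (K : fieldType) (m : nat).
Implicit Types (f : {mpoly K[m]}) (J : {set 'I_m}).

Definition affine_coef f J : K := f@_(mesym1 J).

Definition affine_pt (R : pzRingType) (x : 'I_m -> R) (i : 'I_m) (c : bool) : R :=
  if c then x i else 1.

Lemma mnm_mesym1 (mu : 'X_{1..m}) : (forall i, (mu i <= 1)%N) ->
  mu = mesym1 [set i | mu i == 1%N].
Proof.
move=> mu1; apply/mnmP => i; rewrite mnmE inE.
by have := mu1 i; case: (mu i) => [|[|?]].
Qed.

Lemma multiaffine_expand f : multiaffine f ->
  f = \sum_J affine_coef f J *: 'X_[mesym1 J].
Proof.
move=> fa; apply/mpolyP => mu; rewrite raddf_sum /=.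
under eq_bigr => J _ do rewrite mcoeffZ mcoeffX.
have [mu_f|mu_f] := boolP (mu \in msupp f).
  have muE := mnm_mesym1 (fa mu mu_f).
  rewrite [in RHS]muE (bigD1 [set i | mu i == 1%N]) //= eqxx mulr1 big1 ?addr0.
    by rewrite /affine_coef -muE.
  by move=> J neJ; rewrite (inj_eq (@inj_mesym1 m)) (negPf neJ) mulr0.
rewrite memN_msupp_eq0 // big1 // => J _.
case: eqP => [JE|_]; last by rewrite mulr0.
by rewrite /affine_coef JE memN_msupp_eq0 // mul0r.
Qed.

Lemma mmap_maform (R : comNzRingType) (iota : {rmorphism K -> R}) (x : 'I_m -> R) f :
  multiaffine f ->
  mmap iota x f = maform (fun U => iota (affine_coef f U)) (affine_pt x).
Proof.
move=> fa; rewrite {1}(multiaffine_expand fa) raddf_sum /=.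
apply: eq_bigr => J _; rewrite mmapZ mmapX; congr (_ * _).
by apply: eq_bigr => i _; rewrite mnmE /affine_pt; case: (i \in J); rewrite ?expr1 ?expr0.
Qed.

Lemma mmap_mpolyX f : mmap (@mpolyC m K) (fun i => 'X_i) f = f.
Proof.
rewrite [in RHS](mpolyE f) /mmap; apply: eq_bigr => mu _.
rewrite mul_mpolyC; congr (_ *: _); rewrite [RHS]mpolyXE_id.
by apply: eq_bigr.
Qed.

Lemma multiaffine_maform f : multiaffine f ->
  f = maform (fun U => (affine_coef f U)%:MP) (affine_pt (fun i => 'X_i)).
Proof. by move=> fa; rewrite -mmap_maform // mmap_mpolyX. Qed.

Lemma maform_upd2 (R : comPzRingType) (a : {set 'I_m} -> R) w i j u v : i != j ->
  maform a (upd (upd w i u) j v) =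
  let G b c := maform a (upd (upd w i (pt b)) j (pt c)) in
  u false * v false * G false false + u false * v true * G false true
  + u true * v false * G true false + u true * v true * G true true.
Proof.
move=> neij; rewrite maform_upd !(eq_maformr _ (updC w u _ neij)) !(maform_upd a _ i u).
rewrite -!(eq_maformr _ (updC w _ _ neij)) /=.
by move: (maform _ _) (maform _ _) (maform _ _) (maform _ _) => *; ring.
Qed.

(** The form is affine in [x_i], and its value at infinity is the coefficient of [x_i]. *)
Lemma mderiv_maform (b : {set 'I_m} -> K) (w : 'I_m -> bool -> {mpoly K[m]}) i :
  w i =1 affine_pt (fun i => 'X_i) i ->
  (forall k c, k != i -> (w k c)^`M(i) = 0) ->
  (maform (fun U => (b U)%:MP) w)^`M(i) = maform (fun U => (b U)%:MP) (upd w i (pt true)).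
Proof.
move=> wi w0.
have der0 c : (maform (fun U => (b U)%:MP) (upd w i (pt c)))^`M(i) = 0.
  rewrite /maform raddf_sum big1 // => U _; rewrite /= mderiv_mulC.
  suff -> : (\prod_k upd w i (pt c) k (k \in U))^`M(i) = 0 by rewrite mulr0.
  apply: (big_ind (fun p => p^`M(i) = 0)) => [|p q p0 q0|k _].
  - by rewrite -mpolyC1 mderivC.
  - by rewrite mderivM p0 q0 mul0r mulr0 addr0.
  - rewrite /upd; case: eqP => [_|/eqP]; last exact: w0.
    by rewrite /pt -mpolyC_nat mderivC.
rewrite (eq_maformr _ (upd_id w i)) maform_upd !wi /affine_pt mul1r mderivD mderivM !der0.
rewrite mulr0 addr0 add0r mderivX mnm1E eqxx scale1r.
have -> : (U_(i) - U_(i) = 0 :> 'X_{1..m})%MM by apply/mnmP => k; rewrite mnmBE subnn mnm0E.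
by rewrite mpolyX0 mul1r; apply: eq_maformr => k c; rewrite /upd; case: eqP.
Qed.

Lemma rayleigh_diffE f i j : multiaffine f -> i != j ->
  rayleigh_diff i j f =
  rayleigh (fun U => (affine_coef f U)%:MP) i j (affine_pt (fun i => 'X_i)).
Proof.
move=> fa neij; rewrite /rayleigh_diff {3}(multiaffine_maform fa).
set wX := affine_pt _; set b := fun U => _.
have X0 k l c : k != l -> (wX k c)^`M(l) = 0.
  case: c => ne; rewrite /wX /affine_pt; last by rewrite -mpolyC1 mderivC.
  by rewrite mderivX mnm1E (negPf ne) scale0r.
have fE := multiaffine_maform fa.
have fi k : f^`M(k) = maform b (upd wX k (pt true)).
  by rewrite {1}fE; apply: mderiv_maform => // l c /X0.
have fij : f^`M(j)^`M(i) = maform b (upd (upd wX i (pt true)) j (pt true)).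
  rewrite fi mderiv_maform => [|c|k c nek].
  - by rewrite (eq_maformr _ (updC _ _ _ neij)).
  - by rewrite /upd (negPf neij).
  - rewrite /upd; case: eqP => _; last exact: X0.
    by rewrite /pt -mpolyC_nat mderivC.
have fiE : maform b (upd wX i (pt true)) = maform b (upd (upd wX i (pt true)) j (wX j)).
  rewrite (eq_maformr _ (updC _ _ _ neij)); apply: eq_maformr => k c.
  by rewrite /upd; case: eqP => // _; case: eqP => // ->.
have fjE : maform b (upd wX j (pt true)) = maform b (upd (upd wX i (wX i)) j (pt true)).
  by apply: eq_maformr => k c; rewrite /upd; case: eqP => // _; case: eqP => // ->.
have fE2 : maform b wX = maform b (upd (upd wX i (wX i)) j (wX j)).
  apply: eq_maformr => k c; rewrite /upd.
  by case: eqP => [->//|_]; case: eqP => // ->.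
rewrite fij !fi fiE fjE fE2.
rewrite !(maform_upd2 _ _ (wX i) _ neij) !(maform_upd2 _ _ (pt true) _ neij) /rayleigh /=.
move: (maform _ _) (maform _ _) (maform _ _) (maform _ _) => *.
by rewrite /wX /affine_pt /pt /=; ring.
Qed.
End MpolyForm.

Lemma eq_rayleigh (R : comPzRingType) m (a a' : {set 'I_m} -> R) w w' i j :
  a =1 a' -> (forall k, k != i -> k != j -> w k =1 w' k) ->
  rayleigh a i j w = rayleigh a' i j w'.
Proof.
move=> eqa eqw; rewrite /rayleigh.
have eqF b c : maform a (upd (upd w i (pt b)) j (pt c)) =
    maform a' (upd (upd w' i (pt b)) j (pt c)).
  apply: eq_maform => // k e; rewrite /upd.
  by have [//|nej] := eqVneq k j; have [//|nei] := eqVneq k i; rewrite eqw.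
by rewrite !eqF.
Qed.

Lemma map_rayleigh (R S : comPzRingType) (f : {rmorphism R -> S}) m
    (a : {set 'I_m} -> R) w i j :
  f (rayleigh a i j w) = rayleigh (fun U => f (a U)) i j (fun k c => f (w k c)).
Proof.
have fF b c : f (maform a (upd (upd w i (pt b)) j (pt c))) =
    maform (fun U => f (a U)) (upd (upd (fun k c => f (w k c)) i (pt b)) j (pt c)).
  rewrite map_maform; apply: eq_maformr => k e; rewrite /upd.
  by case: (k == j); case: (k == i); rewrite /pt ?rmorph_nat.
by rewrite rmorphB !rmorphM /= !fF.
Qed.

Lemma maform_scale (R : comPzRingType) m (a : {set 'I_m} -> R) w (q : 'I_m -> R) :
  maform a (fun k c => q k * w k c) = (\prod_k q k) * maform a w.
Proof.
rewrite /maform mulr_sumr; apply: eq_bigr => U _.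
by rewrite big_split /= mulrCA.
Qed.

Lemma rayleigh_scale (R : comPzRingType) m (a : {set 'I_m} -> R) w q i j :
  q i = 1 -> q j = 1 ->
  rayleigh a i j (fun k c => q k * w k c) = (\prod_k q k) ^+ 2 * rayleigh a i j w.
Proof.
move=> qi qj; rewrite /rayleigh.
have qF b c : maform a (upd (upd (fun k c => q k * w k c) i (pt b)) j (pt c)) =
    (\prod_k q k) * maform a (upd (upd w i (pt b)) j (pt c)).
  rewrite -maform_scale; apply: eq_maformr => k e; rewrite /upd.
  by case: eqP => [->|_]; [rewrite qj mul1r|case: eqP => [->|//]; rewrite qi mul1r].
rewrite !qF; move: (\prod_k _) (maform _ _) (maform _ _) (maform _ _) (maform _ _) => *.
by ring.
Qed.

Lemma mmap_map_mpoly (K K' : fieldType) (sigma : {rmorphism K -> K})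
    (sigma' : {rmorphism K' -> K'}) (iota : {rmorphism K -> K'}) m (x : 'I_m -> K')
    (g : {mpoly K[m]}) :
  (forall c, sigma' (iota c) = iota (sigma c)) -> (forall k, sigma' (x k) = x k) ->
  mmap iota x (map_mpoly sigma g) = sigma' (mmap iota x g).
Proof.
move=> iotaE xR; rewrite /map_mpoly [mmap (_ \o _) _ g]/mmap [in RHS]/mmap !rmorph_sum.
apply: eq_bigr => mu _; rewrite rmorphM [RHS]rmorphM /= mmapC mmap1_id mmapX iotaE.
by congr (_ * _); rewrite rmorph_prod; apply: eq_bigr => i _; rewrite rmorphXn /= xR.
Qed.

(** * From Hermitian square polynomials to norms at points *)

Section NormsAtPoints.
Variables (K : fieldType) (sigma : {rmorphism K -> K}) (m : nat) (f : {mpoly K[m]}).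
Hypothesis fa : multiaffine f.
Variables (i j : 'I_m).
Hypotheses (neij : i != j) (hsq : hermitian_square sigma (rayleigh_diff i j f)).

(** Evaluate the Hermitian square at the affine point [w k true / w k false]; clearing denominators
    multiplies by the square of a fixed element. *)
Lemma rayleigh_norm_affine (K' : fieldType) (sigma' : {rmorphism K' -> K'})
    (iota : {rmorphism K -> K'}) (w : 'I_m -> bool -> K') :
  (forall c, sigma' (iota c) = iota (sigma c)) ->
  (forall k c, sigma' (w k c) = w k c) -> (forall k, w k false != 0) ->
  exists z, rayleigh (fun U => iota (affine_coef f U)) i j w = z * sigma' z.
Proof.
move=> iotaE wR w0; have [g gE] := hsq.
pose x k := w k true / w k false.
have xR k : sigma' (x k) = x k by rewrite /x rmorphM fmorphV !wR.
pose q := upd (upd (fun k => w k false) i 1) j 1.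
have qR : sigma' (\prod_k q k) = \prod_k q k.
  rewrite rmorph_prod; apply: eq_bigr => k _.
  by rewrite /q /upd; case: (k == j); case: (k == i); rewrite ?rmorph1 ?wR.
exists ((\prod_k q k) * mmap iota x g).
rewrite rmorphM qR mulrACA -(mmap_map_mpoly g iotaE xR) -rmorphM /= -gE.
rewrite rayleigh_diffE // map_rayleigh -expr2 -rayleigh_scale; last first.
- by rewrite /q /upd eqxx.
- by rewrite /q /upd eqxx (negPf neij).
apply: eq_rayleigh => [U|k nei nej c]; first by rewrite /= mmapC.
rewrite /q /upd (negPf nei) (negPf nej) /affine_pt /=.
case: c; last by rewrite rmorph1 mulr1.
by rewrite mmapX mmap1U /x mulrC divfK.
Qed.

(* At a point with vanishing denominators, perturb them by an indeterminate and *)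
(* specialize it to [0].                                                        *)
Lemma rayleigh_norm_point (K' : fieldType) (sigma' : {rmorphism K' -> K'})
    (iota : {rmorphism K -> K'}) (w : 'I_m -> bool -> K') :
  (forall c, sigma' (iota c) = iota (sigma c)) ->
  (forall k c, sigma' (w k c) = w k c) ->
  exists z, rayleigh (fun U => iota (affine_coef f U)) i j w = z * sigma' z.
Proof.
move=> iotaE wR.
pose wX k c : {poly K'} := (w k c)%:P + (if ~~ c && (w k c == 0) then 'X else 0).
pose P := rayleigh (fun U => (iota (affine_coef f U))%:P) i j wX.
pose io : {rmorphism K -> {fraction {poly K'}}} := (ratfun_cst K' \o iota).
have [|||z zE] := @rayleigh_norm_affine _ (ratfun_map sigma') io (fun k c => (wX k c)%:F).
- by move=> c; rewrite -[LHS]/(ratfun_map sigma' (ratfun_cst K' (iota c))) ratfun_cst_map iotaE.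
- move=> k c; rewrite /= ratfun_map_tofrac /wX rmorphD /= map_polyC /= wR.
  by case: ifP => _; rewrite ?map_polyX ?rmorph0.
- move=> k; rewrite tofrac_eq0 /wX /=; have [->|wk] := eqVneq (w k false) 0.
    by rewrite add0r polyX_eq0.
  by rewrite addr0 polyC_eq0.
have PE : P%:F = z * ratfun_map sigma' z by rewrite -zE /P map_rayleigh.
have [c cE] := norm_specialize PE; exists c; rewrite -cE.
rewrite -[P.[0]]/(horner_eval 0 P) map_rayleigh; apply: eq_rayleigh => [U|k _ _ e].
  by rewrite /= /horner_eval hornerC.
rewrite /= /horner_eval /wX hornerD hornerC.
by case: ifP => _; rewrite ?hornerX ?hornerC ?horner0 addr0.
Qed.
End NormsAtPoints.

(** * Inversion of variables *)

Section Flip.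
Variables (R : comNzRingType) (m : nat) (S : {set 'I_m}).
Implicit Types (b : {set 'I_m} -> R) (U : {set 'I_m}).

Definition flip U : {set 'I_m} := [set i | (i \in U) (+) (i \in S)].

Definition flip_sign (i : 'I_m) (c : bool) : R := if c && (i \notin S) then -1 else 1.

(* The coefficients of the polynomial obtained from the one with coefficients   *)
(* [b] by the substitutions [x_i := - 1 / x_i] for [i] outside [S], cleared of  *)
(* denominators and indexed by the missing variables.                           *)
Definition flip_coef b U : R := (\prod_i flip_sign i (i \in U)) * b (flip U).

Definition flip_point (w : 'I_m -> bool -> R) i c : R :=
  flip_sign i (c (+) (i \in S)) * w i (c (+) (i \in S)).

Lemma flipK : involutive flip.
Proof. by move=> U; apply/setP => i; rewrite !inE -addbA addbb addbF. Qed.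

Lemma maform_flip b w : maform (flip_coef b) w = maform b (flip_point w).
Proof.
rewrite /maform (reindex_inj (can_inj flipK)); apply: eq_bigr => U _.
rewrite /flip_coef flipK mulrAC mulrC -big_split; congr (_ * _).
by apply: eq_bigr => i _; rewrite /flip_point !inE.
Qed.

(** The coordinates at [i] and at [j] each undergo a linear change of determinant -1: a swap inside
    [S], a sign outside. A Rayleigh difference is minus a determinant of order two, so the two signs
    cancel. *)
Lemma rayleigh_flip b w i j : i != j ->
  rayleigh (flip_coef b) i j w = rayleigh b i j (flip_point w).
Proof.
move=> neij; rewrite /rayleigh !maform_flip.
have flipE c d : maform b (flip_point (upd (upd w i (pt c)) j (pt d))) =
    maform b (upd (upd (flip_point w) i
      (fun e => flip_sign i (e (+) (i \in S)) * pt c (e (+) (i \in S)))) j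
      (fun e => flip_sign j (e (+) (j \in S)) * pt d (e (+) (j \in S)))).
  apply: eq_maformr => k e; rewrite /flip_point /upd.
  by have [->//|nej] := eqVneq k j; have [->|] := eqVneq k i.
rewrite !flipE !(maform_upd2 _ _ _ _ neij) /= /flip_sign.
move: (maform _ _) (maform _ _) (maform _ _) (maform _ _) => *.
by case: (i \in S); case: (j \in S); rewrite /pt /=; ring.
Qed.
End Flip.

(* For Hermitian [A = [[P, B], [B^*, 0]]] with blocks indexed by [S] and its    *)
(* complement [T], this is the Schur complement computation                     *)
(* [\det (X_S + P + B X_T B^* ) = \det [[X_S + P, B], [- X_T B^*, 1]]].          *)
Lemma det_pencil_block (R : comNzRingType) m (x : 'I_m -> R) (A : 'M[R]_m) (S : {set 'I_m}) :
  (forall i j, i \notin S -> j \notin S -> A i j = 0) ->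
  pminor (\matrix_(i, j) (x i * (i == j)%:R + A i j +
            \sum_(k | k \notin S) A i k * x k * A k j)) S =
  \det (\matrix_(i, j) ((if i \in S then x i else 1) * (i == j)%:R
            + (if i \in S then 1 else - x i) * A i j)).
Proof.
move=> A0; set Q := \matrix_(i, j) _; set M := \matrix_(i, j) _.
pose L : 'M[R]_m := \matrix_(i, j) ((i == j)%:R +
  (if (i \notin S) && (j \in S) then x i * A i j else 0)).
have detL : \det L = 1.
  transitivity (pminor (1%:M : 'M[R]_m) (~: S)).
    rewrite -(@eq_pminor _ _ L) => [|i j]; last first.
      by rewrite !inE !mxE => _ /negPf ->; rewrite andbF addr0.
    congr (\det _); apply/matrixP => i j; rewrite !mxE inE.
    by case: (i \in S); rewrite //= addr0.
  rewrite -[RHS](det1 R m); congr (\det _); apply/matrixP => i j.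
  by rewrite !mxE; case: ifP.
have MLE i j : (M *m L) i j = M i j +
    (if j \in S then \sum_(k | k \notin S) M i k * (x k * A k j) else 0).
  rewrite mxE.
  under eq_bigr => k _ do rewrite [L k j]mxE mulrDr.
  rewrite big_split /= (bigD1 j) //= eqxx mulr1 big1 ?addr0 => [|k /negPf ->]; last by rewrite
    mulr0.
  congr (_ + _); case: ifP => jS; last by rewrite big1 // => k _; rewrite andbF mulr0.
  rewrite [RHS]big_mkcond; apply: eq_bigr => k _.
  by rewrite andbT; case: ifP => _; rewrite ?mulr0.
rewrite -[RHS]mulr1 -detL -det_mulmx -[RHS]/(\det (M *m L)).
transitivity (pminor (M *m L) S).
  apply: eq_pminor => i j iS jS; rewrite MLE jS !mxE iS mul1r; congr (_ + _).
  apply: eq_bigr => k kS; rewrite !mxE iS.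
  have /negPf -> : i != k by apply: contraNneq kS => <-.
  by rewrite mulr0 add0r mul1r mulrA.
congr (\det _); apply/matrixP => i j; rewrite mxE; case: ifPn => // iS.
rewrite MLE !mxE (negPf iS) mul1r; case: ifP => jS; last by rewrite A0 ?jS // mulr0 !addr0.
rewrite (bigD1 i) //= !mxE eqxx (negPf iS) (A0 i i) // mulr0 addr0 mulr1 mul1r.
rewrite big1 => [|k /andP[kS nek]]; last by rewrite !mxE eq_sym (negPf nek) (negPf iS) (A0 i k)
  // !mulr0 addr0 mul0r.
by rewrite addr0 mulNr addrNK.
Qed.

(** * From principal minors to a representation of size [deg f] *)

Section Pencil.
Variables (K : fieldType) (sigma : {rmorphism K -> K}) (n m : nat).
Variables (V : 'M[K]_(n, m)) (W : 'M[K]_n).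

Lemma pencil_diagE : pencil_diag sigma V W = \matrix_(a, b)
  (\sum_j (V a j)%:MP * 'X_j * (sigma (V b j))%:MP + (W a b)%:MP).
Proof.
apply/matrixP => a b; rewrite !mxE; congr (_ + _); apply: eq_bigr => j _.
by rewrite mul_mx_diag !mxE.
Qed.

Lemma pencil_sumE : pencil_sum sigma V W = pencil_diag sigma V W.
Proof.
rewrite pencil_diagE; apply/matrixP => a b; rewrite !mxE; congr (_ + _).
rewrite summxE; apply: eq_bigr => j _; rewrite !mxE big_ord1 !mxE mpolyCM.
by rewrite mulrCA mulrA.
Qed.
End Pencil.

Section FromMinors.
Variables (K : fieldType) (sigma : {rmorphism K -> K}) (m : nat) (f : {mpoly K[m]}).
Hypotheses (fa : multiaffine f) (fF : f \is a mpolyOver m (fixed_field sigma)).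
Hypothesis sigmaK : involutive sigma.
Local Notation b := (affine_coef f).

Lemma affine_coefR J : sigma (b J) = b J.
Proof.
have [J_f|J_f] := boolP (mesym1 J \in msupp f); last first.
  by rewrite /affine_coef memN_msupp_eq0 // rmorph0.
have /allP fFJ : all (mem (fixed_field sigma)) [seq f@_mu | mu <- msupp f] by exact: fF.
by have /eqP := fFJ _ (map_f (fun mu => f@_mu) J_f).
Qed.

(** Columns of [V] in [S] are unit vectors, the others come from the off-diagonal block of [A].
    [det_pencil_block] and [det_maform] expand the determinant, and undoing the flip gives [f]. *)
Lemma det_rep_of_minors (S : {set 'I_m}) (A : 'M[K]_m) : b S != 0 ->
  (forall i j, A j i = sigma (A i j)) ->
  (forall i j, i \notin S -> j \notin S -> A i j = 0) ->
  (forall U, pminor A U = flip_coef S b U / b S) ->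
  hermitian_det_rep sigma f #|S|.
Proof.
move=> bS hA A0 pA; pose s (i : 'I_#|S|) : 'I_m := enum_val i.
have sI : injective s by exact: enum_val_inj.
have sS i : s i \in S by exact: enum_valP.
pose V : 'M[K]_(#|S|, m) := \matrix_(i, j) if j \in S then (s i == j)%:R else A (s i) j.
pose W : 'M[K]_#|S| := \matrix_(i, j) A (s i) (s j).
have fE : f = b S *: \det (pencil_diag sigma V W); last first.
  exists (b S), V, W; split; [by apply/eqP/affine_coefR| |exact: fE|].
  - by apply/matrixP => i j; rewrite !mxE -hA.
  - by rewrite pencil_sumE.
pose AX : 'M[{mpoly K[m]}]_m := map_mx (@mpolyC m K) A.
pose Q := \matrix_(i, j) ('X_i * (i == j)%:R + AX i j +
   \sum_(k | k \notin S) AX i k * 'X_k * AX k j) : 'M[{mpoly K[m]}]_m.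
have -> : pencil_diag sigma V W = mxsub s s Q.
  rewrite pencil_diagE; apply/matrixP => i j; rewrite !mxE addrAC; congr (_ + _).
  rewrite (bigID (mem S)) /=; congr (_ + _).
    rewrite (bigD1 (s i)) //= big1 => [|k /andP[kS nek]].
      by rewrite !mxE sS eqxx rmorph_nat mpolyC_nat mul1r addr0 mpolyC_nat eq_sym.
    by rewrite !mxE kS [s i == k]eq_sym (negPf nek) mpolyC0 !mul0r.
  apply: eq_bigr => k kS; rewrite !mxE (negPf kS) -hA //.
rewrite det_mxsub_pminor //.
have -> : [set s k | k : 'I_#|S|] = S.
  apply/setP => k; apply/imsetP/idP => [[l _ ->] //|kS].
  by exists (enum_rank_in kS k); rewrite // /s enum_rankK_in.
rewrite det_pencil_block; last by move=> i j iS jS; rewrite mxE A0 // mpolyC0.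
rewrite det_maform -mul_mpolyC.
have -> : maform (pminor AX) (fun i c => if c then (if i \in S then 1 else - 'X_i)
    else (if i \in S then 'X_i else 1)) =
    (b S)^-1%:MP * maform (flip_coef S (fun U => (b U)%:MP)) (fun i c =>
      if c then (if i \in S then 1 else - 'X_i) else (if i \in S then 'X_i else 1)).
  rewrite /maform mulr_sumr; apply: eq_bigr => U _; rewrite mulrA; congr (_ * _).
  rewrite map_pminor /= pA mpolyCM mulrC; congr (_ * _).
  rewrite /flip_coef mpolyCM; congr (_ * _).
  rewrite -[LHS]/(mpolyC m (\prod_i _)) rmorph_prod; apply: eq_bigr => i _.
  by rewrite /flip_sign; case: ifP => _; rewrite ?rmorphN ?rmorph1.
rewrite mulrA -mpolyCM divff // mpolyC1 mul1r maform_flip.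
rewrite {1}(multiaffine_maform fa); apply: eq_maformr => i c.
rewrite /flip_point /flip_sign /affine_pt.
by case: c; case: (i \in S); rewrite /= ?mul1r ?mulr1 ?mulN1r ?opprK.
Qed.

(** The second derivative vanishes, leaving the square of a derivative with fixed coefficients. *)
Lemma hermitian_square_diag i : hermitian_square sigma (rayleigh_diff i i f).
Proof.
have fii : f^`M(i)^`M(i) = 0.
  apply/mpolyP => mu; rewrite !mcoeff_deriv mcoeff0 memN_msupp_eq0 ?mul0rn //.
  apply/negP => /fa/(_ i); rewrite !mnmDE mnm1E eqxx; lia.
have fR : map_mpoly sigma f = f.
  apply/mpolyP => mu; rewrite mcoeff_map_mpoly /=.
  have [mu_f|mu_f] := boolP (mu \in msupp f); last by rewrite memN_msupp_eq0 // rmorph0.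
  by rewrite (mnm_mesym1 (fa mu_f)) affine_coefR.
exists f^`M(i); rewrite /rayleigh_diff fii mulr0 subr0; congr (_ * _).
apply/mpolyP => mu; rewrite mcoeff_map_mpoly !mcoeff_deriv /= rmorphMn /=.
by rewrite -[in RHS](mcoeff_map_mpoly sigma) fR.
Qed.

Lemma affine_coef_gt_deg (J : {set 'I_m}) : (mpdeg f < #|J|)%N -> b J = 0.
Proof.
move=> ltJ; rewrite /affine_coef memN_msupp_eq0 // msize_mdeg_ge // mdeg_mesym1.
by rewrite (leq_trans (leqSpred _)).
Qed.

Lemma affine_coef_deg : f != 0 -> exists2 S : {set 'I_m}, b S != 0 & #|S| = mpdeg f.
Proof.
move=> f0; have lead_f := mlead_supp f0.
have muE := mnm_mesym1 (fa lead_f); exists [set i | mlead f i == 1%N].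
  by rewrite /affine_coef -muE -mcoeff_msupp.
by rewrite -mdeg_mesym1 -muE /mpdeg -mlead_deg.
Qed.

Lemma flip_real (S U : {set 'I_m}) : sigma (flip_coef S b U / b S) = flip_coef S b U / b S.
Proof.
rewrite rmorphM fmorphV rmorphM /= !affine_coefR; congr (_ * _ / _).
rewrite rmorph_prod; apply: eq_bigr => i _; rewrite /flip_sign.
by case: ifP => _; rewrite ?rmorphN ?rmorph1.
Qed.

Lemma flip_rayleigh_norms (S : {set 'I_m}) : b S != 0 ->
  (forall i j, hermitian_square sigma (rayleigh_diff i j f)) ->
  rayleigh_norms sigma setT (fun U => flip_coef S b U / b S).
Proof.
move=> bS hsq K' sigma' iota iotaE w wR _ i j _ _ neij.
have flR k c : sigma' (flip_point S w k c) = flip_point S w k c.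
  rewrite /flip_point /flip_sign rmorphM wR.
  by case: ifP => _; rewrite ?rmorphN rmorph1.
have [z zE] := rayleigh_norm_point fa neij (hsq i j) iotaE flR.
have bSN0 : iota (b S) != 0 by rewrite fmorph_eq0.
exists (z / iota (b S)); rewrite rmorphM fmorphV iotaE affine_coefR mulf_div -zE.
rewrite -rayleigh_flip //.
set a := flip_coef S (fun U => iota (b U)); set c := iota (b S).
have aE U : iota (flip_coef S b U / b S) = c^-1 * a U.
  rewrite rmorphM fmorphV mulrC /a /flip_coef rmorphM; congr (_ * (_ * _)).
  rewrite rmorph_prod; apply: eq_bigr => k _; rewrite /flip_sign.
  by case: ifP => _; rewrite ?rmorphN rmorph1.
have formE w' : maform (fun U => iota (flip_coef S b U / b S)) w' = c^-1 * maform a w'.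
  by rewrite /maform mulr_sumr; apply: eq_bigr => U _; rewrite aE -mulrA.
rewrite /rayleigh !formE; move: (maform _ _) (maform _ _) (maform _ _) (maform _ _) => *.
by field; rewrite bSN0.
Qed.

Lemma det_rep_of_rayleigh :
  (forall i j, hermitian_square sigma (rayleigh_diff i j f)) ->
  hermitian_det_rep sigma f (mpdeg f).
Proof.
move=> hsq; have [f0|f0] := eqVneq f 0.
  rewrite f0; exists 0, 0, 0; rewrite !scale0r; split=> //; first by apply/eqP/rmorph0.
  by apply/matrixP => i j; rewrite !mxE rmorph0.
have [S bS degS] := affine_coef_deg f0; rewrite -degS.
have flip0 : flip S set0 = S by apply/setP => i; rewrite !inE.
have [|A [hA pA]] := hermitian_of_principal_minors sigmaK _ (flip_real S) (flip_rayleigh_norms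
  bS hsq).
  rewrite /flip_coef flip0 big1 ?mul1r ?divff // => i _.
  by rewrite /flip_sign inE.
have {}pA U : pminor A U = flip_coef S b U / b S by apply: pA; apply: subsetT.
(* For such [U], [flip S U] is the union of [U] and [S], larger than the degree of [f]. *)
have A_0 (U : {set 'I_m}) : U != set0 -> [disjoint U & S] -> pminor A U = 0.
  move=> U0 US; rewrite pA /flip_coef (@affine_coef_gt_deg (flip S U)) ?mulr0 ?mul0r //.
  have -> : flip S U = U :|: S.
    apply/setP => i; rewrite !inE; have := disjointFr US (x := i).
    by case: (i \in U) => [->|_] //; rewrite addbC.
  by rewrite -degS cardsU disjoint_setI0 // cards0 subn0 -[X in (X < _)%N]add0n ltn_add2r
    card_gt0.
apply: (det_rep_of_minors bS hA _ pA) => i j iS jS.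
have dis (k : 'I_m) : k \notin S -> A k k = 0.
  move=> kS; rewrite -pminor1 A_0 ?disjoints1 // -card_gt0 cards1 //.
have [<-|ne] := eqVneq i j; first exact: dis.
have : pminor A [set i; j] = 0.
  apply: A_0; first by rewrite -card_gt0 cards2.
  by rewrite disjoints_subset; apply/subsetP => k; rewrite !inE => /orP[] /eqP ->.
rewrite pminor2 // !dis // mul0r sub0r (hA i j) => /eqP.
by rewrite oppr_eq0 mulf_eq0 fmorph_eq0 orbb => /eqP.
Qed.
End FromMinors.

(** * Necessity: Rayleigh differences of a Hermitian pencil *)

Lemma det1_mulC (R : comPzRingType) p q (A : 'M[R]_(p, q)) (B : 'M[R]_(q, p)) :
  \det (1%:M + A *m B) = \det (1%:M + B *m A).
Proof.
pose M := block_mx 1%:M A (- B) 1%:M.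
have MU : M *m block_mx 1%:M 0 B 1%:M = block_mx (1%:M + A *m B) A 0 1%:M.
  by rewrite mulmx_block !mul1mx !mulmx1 !mulmx0 !add0r addNr.
have UM : block_mx 1%:M 0 B 1%:M *m M = block_mx 1%:M A 0 (1%:M + B *m A).
  by rewrite mulmx_block !mul1mx !mul0mx !mulmx1 !addr0 subrr addrC.
have := congr1 determinant MU; have := congr1 determinant UM.
by rewrite !det_mulmx !det_lblock !det_ublock !det1 !(mul1r, mulr1) => -> ->.
Qed.

Lemma det_block11 (R : comNzRingType) (a b c d : 'M[R]_1) :
  \det (block_mx a b c d : 'M_(1 + 1)) = a 0 0 * d 0 0 - b 0 0 * c 0 0.
Proof.
rewrite (@det_mx22 R (block_mx a b c d)).
rewrite -(block_mxEul a b c d) -(block_mxEur a b c d) -(block_mxEdl a b c d) -(block_mxEdr a b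
  c d).
by congr (_ * _ - _ * _); congr (block_mx _ _ _ _ _ _); apply: val_inj.
Qed.

(** By [det1_mulC], each update is [\det M] times a determinant of order one or two in [invmx M];
    only the product of off-diagonal entries survives. *)
Lemma det_rank_two_field (F : fieldType) n (M : 'M[F]_n) (u w : 'cV_n) (u' w' : 'rV_n) :
  \det M != 0 ->
  \det (M + u *m u') * \det (M + w *m w') - \det M * \det (M + u *m u' + w *m w') =
  (u' *m \adj M *m w) 0 0 * (w' *m \adj M *m u) 0 0.
Proof.
move=> M0; have MU : M \in unitmx by rewrite unitmxE unitfE.
have adjE : \adj M = \det M *: invmx M by rewrite /invmx MU scalerA divff // scale1r.
have detE q (A : 'M_(n, q)) (B : 'M_(q, n)) :
    \det (M + A *m B) = \det M * \det (1%:M + B *m invmx M *m A).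
  rewrite -mulmxA -det1_mulC -det_mulmx mulmxDr mulmx1 !mulmxA.
  by rewrite mulmxV // mul1mx.
have -> : M + u *m u' + w *m w' = M + row_mx u w *m col_mx u' w'.
  by rewrite mul_row_col addrA.
rewrite !detE mul_col_mx mul_col_row (scalar_mx_block 1 1 1) add_block_mx !add0r det_block11 adjE.
rewrite -!scalemxAr -!scalemxAl !det_mx11 !mxE.
by move: (\det M) => x; ring.
Qed.

Lemma det_rank_two (R : idomainType) n (M : 'M[R]_n) (u w : 'cV_n) (u' w' : 'rV_n) :
  \det M != 0 ->
  \det (M + u *m u') * \det (M + w *m w') - \det M * \det (M + u *m u' + w *m w') =
  (u' *m \adj M *m w) 0 0 * (w' *m \adj M *m u) 0 0.
Proof.
move=> M0; apply/eqP; rewrite -tofrac_eq; apply/eqP.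
pose t := @FracField.tofrac R.
have := @det_rank_two_field _ n (map_mx t M) (map_mx t u) (map_mx t w) (map_mx t u') (map_mx t
  w').
rewrite -!map_mx_adj -!map_mxM -!map_mxD !det_map_mx tofrac_eq0 => /(_ M0).
by rewrite !mxE tofracB !tofracM.
Qed.

(** Affinity in [x_i] and [x_j] turns derivatives into unit shifts, which in a pencil are rank-one
    updates. *)
Lemma rayleigh_shift (R : comPzRingType) m (a : {set 'I_m} -> R) i j (x : 'I_m -> R) :
  i != j ->
  let F s t := maform a (affine_pt (fun k => x k + s * (k == i)%:R + t * (k == j)%:R)) in
  rayleigh a i j (affine_pt x) = F 1 0 * F 0 1 - F 0 0 * F 1 1.
Proof.
move=> neij F.
have FE s t : F s t = maform a (upd (upd (affine_pt x)
    i (fun c : bool => if c then x i + s else 1)) j (fun c : bool => if c then x j + t else 1)).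
  apply: eq_maformr => k c; rewrite /upd /affine_pt; have [->|nej] := eqVneq k j.
    by rewrite [j == i]eq_sym (negPf neij) mulr0 addr0 mulr1.
  have [->|nei] := eqVneq k i; first by rewrite mulr1 mulr0 addr0.
  by rewrite !mulr0 !addr0.
rewrite !FE !(maform_upd2 _ _ _ _ neij) /rayleigh /=.
by move: (maform _ _) (maform _ _) (maform _ _) (maform _ _) => *; ring.
Qed.

Lemma sum_shift_scale (R : comNzRingType) p n m (x : 'I_m -> R) (P : 'I_m -> 'M[R]_(p, n)) i j
  s t :
  \sum_k (x k + s * (k == i)%:R + t * (k == j)%:R) *: P k =
  \sum_k x k *: P k + s *: P i + t *: P j.
Proof.
have pick c k : \sum_l (c * (l == k)%:R) *: P l = c *: P k.
  rewrite (bigD1 k) //= eqxx mulr1 big1 ?addr0 // => l /negPf ->.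
  by rewrite mulr0 scale0r.
rewrite -(pick s i) -(pick t j) -!big_split; apply: eq_bigr => k _.
by rewrite !scalerDl.
Qed.

Section DetRepNorms.
Variables (K : fieldType) (sigma : {rmorphism K -> K}) (n m : nat).
Hypothesis sigmaK : involutive sigma.
Variables (V : 'M[K]_(n, m)) (W : 'M[K]_n).
Hypothesis hW : hermitian_mx sigma W.

Let cv i : 'cV_n := cst_mx m (col i V).
Let rv i : 'rV_n := cst_mx m (conj_trmx sigma (col i V)).
Let M := pencil_sum sigma V W.

Lemma pencil_sum_cst : M = \sum_k 'X_k *: (cv k *m rv k) + cst_mx m W.
Proof.
have cvrv k : cst_mx m (col k V *m conj_trmx sigma (col k V)) = cv k *m rv k.
  exact: map_mxM.
by rewrite /M /pencil_sum; under eq_bigr => k _ do rewrite cvrv.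
Qed.

Lemma map_pencil_sum (x : 'I_m -> {mpoly K[m]}) :
  map_mx (mmap (@mpolyC m K) x) M = \sum_k x k *: (cv k *m rv k) + cst_mx m W.
Proof.
rewrite map_mxD map_mx_sum; congr (_ + _); last first.
  by apply/matrixP => a b; rewrite !mxE /= mmapC.
apply: eq_bigr => k _; apply/matrixP => a b.
rewrite /cv /rv -map_mxM !mxE !big_ord1 !mxE /=.
by rewrite (rmorphM (mmap _ _)) /= mmapX mmap1U mmapC.
Qed.

Lemma conj_pencil_sum : map_mx (map_mpoly sigma) M = M^T.
Proof.
rewrite /M pencil_sumE pencil_diagE; apply/matrixP => a b; rewrite !mxE rmorphD rmorph_sum /=.
congr (_ + _); last by rewrite map_mpolyC [in RHS]hW !mxE.
apply: eq_bigr => k _; rewrite !rmorphM /= !map_mpolyC map_mpolyX /= sigmaK.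
by rewrite mulrC mulrA [RHS]mulrAC mulrAC.
Qed.

(** [det_rank_two] gives a product of two entries, exchanged by conjugation because the pencil is
    Hermitian. *)
Lemma hermitian_square_det_rep (f : {mpoly K[m]}) (lambda : K) i j :
  multiaffine f -> lambda \in fixed_field sigma -> f = lambda *: \det M ->
  i != j -> hermitian_square sigma (rayleigh_diff i j f).
Proof.
move=> fa /eqP lR fE neij.
(* [det_rank_two] requires a nonzero determinant; otherwise [f = 0]. *)
have [M0|M0] := eqVneq (\det M) 0.
  exists 0; rewrite mul0r fE M0 scaler0 /rayleigh_diff !mderiv0.
  by rewrite !mul0r subrr.
have FE (s t : {mpoly K[m]}) :
    maform (fun U => (affine_coef f U)%:MP)
      (affine_pt (fun k => 'X_k + s * (k == i)%:R + t * (k == j)%:R)) =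
    lambda%:MP * \det (M + s *: (cv i *m rv i) + t *: (cv j *m rv j)).
  rewrite -mmap_maform // {1}fE mmapZ; congr (_ * _).
  rewrite -det_map_mx map_pencil_sum; congr (\det _).
  rewrite (sum_shift_scale (fun k => 'X_k) (fun k => cv k *m rv k)) pencil_sum_cst.
  move: (\sum_k _) (s *: _) (t *: _) (cst_mx m W) => A B C D.
  by rewrite -!addrA; congr (_ + _); rewrite addrA [RHS]addrC.
pose g := (rv i *m \adj M *m cv j) 0 0; exists (lambda *: g).
have gE : map_mpoly sigma g = (rv j *m \adj M *m cv i) 0 0.
  have -> : map_mpoly sigma g = map_mx (map_mpoly sigma) (rv i *m \adj M *m cv j) 0 0.
    by rewrite [RHS]mxE.
  rewrite !map_mxM map_mx_adj conj_pencil_sum.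
  have -> : map_mx (map_mpoly sigma) (rv i) = (cv i)^T.
    by apply/matrixP => a b; rewrite !mxE /= map_mpolyC /= sigmaK.
  have -> : map_mx (map_mpoly sigma) (cv j) = (rv j)^T.
    by apply/matrixP => a b; rewrite !mxE /= map_mpolyC.
  by rewrite -trmx_adj -!trmx_mul mxE mulmxA.
rewrite map_mpolyZ lR gE rayleigh_diffE // rayleigh_shift // !FE.
rewrite !scale0r !scale1r !addr0 -!mul_mpolyC.
have := det_rank_two (cv i) (cv j) (rv i) (rv j) M0; rewrite -/g => detE.
have factor (R : comNzRingType) (l a b c d : R) :
    l * a * (l * b) - l * c * (l * d) = l * l * (a * b - c * d) by ring.
by rewrite factor detE mulrACA.
Qed.
End DetRepNorms.

Theorem theorem5p6 (K : fieldType) (sigma : {rmorphism K -> K})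
    (hsigma : order_two sigma) (m : nat) (f : {mpoly K[m]})
    (hfF : f \is a mpolyOver m (fixed_field sigma))
    (hf : multiaffine f) :
  ((exists n : nat, hermitian_det_rep sigma f n) <->
   (forall i j : 'I_m, hermitian_square sigma (rayleigh_diff i j f))) /\
  ((exists n : nat, hermitian_det_rep sigma f n) ->
   hermitian_det_rep sigma f (mpdeg f)).
Proof.
have [sigmaK _] := hsigma.
have norms : (exists n : nat, hermitian_det_rep sigma f n) ->
    forall i j : 'I_m, hermitian_square sigma (rayleigh_diff i j f).
  move=> [n [lambda [V [W [lR hW _ fE]]]]] i j.
  have [<-|neij] := eqVneq i j; last exact: (hermitian_square_det_rep sigmaK hW hf lR fE neij).
  exact: hermitian_square_diag hf hfF _.
have rep := det_rep_of_rayleigh hf hfF sigmaK.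
by split; [split=> // /rep; exists (mpdeg f)|move/norms/rep].
Qed.
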